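(* Let $g\in H(\mathbb{D})$, let $\nu$ be a weight satisfying property (U) and let $\mu$ be a weight. Then the following are equivalent: (1) $S_g: H^{\infty}_\nu\rightarrow \mathcal{B}^{\infty}_\mu$ is compact; (2) $\lim_{|z|\rightarrow1^-}\frac{\mu(z)}{(1-|z|^2)\nu(z)}|g(z)|=0$. If, in addition, $\nu$ and $\mu$ are typical weights, then (1) and (2) are also equivalent to (3) $S_g: H^{0}_\nu\rightarrow \mathcal{B}^{0}_\mu$ is compact.
   Context: $\mathbb{D}$ is the open unit disk and $H(\mathbb{D})$ the space of analytic functions on $\mathbb{D}$. A weight is a non-negative continuous function $\nu$ on $\mathbb{D}$ with $\nu(z)=\nu(|z|)$ for all $z$, which is decreasing in $|z|$. For a weight $\nu$: $H^{\infty}_\nu=\{f\in H(\mathbb{D}): \sup_{z}\nu(z)|f(z)|<\infty\}$, $H^{0}_\nu=\{f\in H(\mathbb{D}): \lim_{|z|\to1^-}\nu(z)|f(z)|=0\}$, $\mathcal{B}^{\infty}_\nu=\{f\in H(\mathbb{D}): |f(0)|+\sup_{z}\nu(z)|f'(z)|<\infty\}$, $\mathcal{B}^{0}_\nu=\{f\in H(\mathbb{D}): \lim_{|z|\to1^-}\nu(z)|f'(z)|=0\}$, each with its natural norm. A weight $\nu$ is typical if $\lim_{|z|\to1^-}\nu(z)=0$. A weight $\nu$ satisfies property (U) if there is $\alpha>0$ such that $r\mapsto \nu(r)/(1-r^2)^\alpha$ is almost increasing on $[0,1)$ (i.e. there is $C>0$ with $h(r)\le C h(s)$ whenever $r\le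 s$), equivalently $\inf_n \nu(1-2^{-(n+1)})/\nu(1-2^{-n})>0$. For $g\in H(\mathbb{D})$, $(S_gf)(z)=\int_0^z f'(\omega)g(\omega)\,d\omega$. *)

(* Defs.v *)
From Stdlib Require Import Reals.
From Coquelicot Require Import Coquelicot.
Open Scope R_scope.

Definition inD (z : C) : Prop := Cmod z < 1.

Definition holoD (f : C -> C) : Prop :=
  forall z : C, inD z -> @ex_derive C_AbsRing C_NormedModule f z.

Definition dC (f : C -> C) (z : C) : C := C_derive f z.

Definition weight (nu : C -> R) : Prop :=
  (forall z, inD z -> 0 <= nu z) /\
  (forall z, inD z -> continuous nu z) /\
  (forall z w, inD z -> inD w -> Cmod z = Cmod w -> nu z = nu w) /\
  (forall z w, inD z -> inD w -> Cmod z <= Cmod w -> nu w <= nu z).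

Definition typical (nu : C -> R) : Prop :=
  forall eps : R, 0 < eps -> exists r : R, r < 1 /\
    forall z, inD z -> r < Cmod z -> Rabs (nu z) < eps.

Definition propU (nu : C -> R) : Prop :=
  exists alpha : R, 0 < alpha /\ exists Cst : R, 0 < Cst /\
    forall r s : R, 0 <= r -> r <= s -> s < 1 ->
      nu (RtoC r) / Rpower (1 - r ^ 2) alpha
      <= Cst * (nu (RtoC s) / Rpower (1 - s ^ 2) alpha).

Definition lim_bdry0 (F : C -> R) : Prop :=
  forall eps : R, 0 < eps -> exists r : R, r < 1 /\
    forall z, inD z -> r < Cmod z -> Rabs (F z) < eps.

Definition Hinf (nu : C -> R) (f : C -> C) : Prop :=
  holoD f /\ exists M : R, forall z, inD z -> nu z * Cmod (f z) <= M.
Definition H0 (nu : C -> R) (f : C -> C) : Prop :=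
  holoD f /\ lim_bdry0 (fun z => nu z * Cmod (f z)).
Definition Binf (mu : C -> R) (f : C -> C) : Prop :=
  holoD f /\ exists M : R, forall z, inD z -> mu z * Cmod (dC f z) <= M.
Definition B0 (mu : C -> R) (f : C -> C) : Prop :=
  holoD f /\ lim_bdry0 (fun z => mu z * Cmod (dC f z)).

Definition Hnorm_le (nu : C -> R) (f : C -> C) (c : R) : Prop :=
  forall z, inD z -> nu z * Cmod (f z) <= c.
Definition Bnorm_le (mu : C -> R) (f : C -> C) (c : R) : Prop :=
  forall z, inD z -> Cmod (f 0) + mu z * Cmod (dC f z) <= c.

(* S_g f (z) = int_0^z f'(w) g(w) dw, along the segment [0,z] *)
Definition Sg (g f : C -> C) (z : C) : C :=
  RInt (V := C_R_CompleteNormedModule)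
       (fun t : R => (dC f (RtoC t * z) * g (RtoC t * z) * z)%C) 0 1.

Definition compact_op (X : (C -> C) -> Prop) (nu : C -> R)
    (Y : (C -> C) -> Prop) (mu : C -> R) (T : (C -> C) -> (C -> C)) : Prop :=
  (forall f, X f -> Y (T f)) /\
  forall fs : nat -> (C -> C),
    (forall n, X (fs n) /\ Hnorm_le nu (fs n) 1) ->
    exists (phi : nat -> nat) (h : C -> C),
      (forall n, (phi n < phi (S n))%nat) /\ Y h /\
      forall eps : R, 0 < eps -> exists N : nat, forall n, (N <= n)%nat ->
        Bnorm_le mu (fun z => (T (fs (phi n)) z - h z)%C) eps.

(* Main.v *)
(* Property (U) gives, through Cauchy's estimate on the disc of radius (1-|z|)/2 about z, the bound
(1-|z|^2) nu(z) |f'(z)| <= K for f in the unit ball of H^inf_nu. Hence (S_g f)' = f' g is small near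
the circle, uniformly in f, when (2) holds; inside, Montel's theorem extracts a locally uniformly
convergent subsequence, and S_g of its limit is the limit of the images. Conversely the functions c
nu(a)^(-1) ((1-|a|^2)/(1-conj(a) z))^(n+1), with n at least the exponent of property (U), lie in the
unit ball, have derivative of the maximal order at a, and their derivatives tend to 0 pointwise as
|a| -> 1, so every norm limit of their images under S_g has zero weighted derivative; compactness
then forces (2). They are bounded, hence lie in H^0_nu when nu is typical, so the same argument
serves (3).

Complex differentiability is assumed only pointwise, so everything rests on Goursat's theorem. It is
proved for the pullback of F(w) dw to the unit square under a map w(s,t): a cone w = s (z + t (u-z))
yields primitives, and a moving circle yields Cauchy's formula. *)
Require Import Defs.
From Stdlib Require Import Reals Arith Lra Lia Classical IndefiniteDescription Cantor.
From Coquelicot Require Import Coquelicot.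
Open Scope R_scope.

(** Each direction is proved once, for unspecified spaces [X] and [Y]. Sufficiency asks that [X]
    consist of analytic functions of finite norm and that [Y] contain the analytic functions with
    vanishing weighted derivative. Necessity asks that [X] contain the bounded analytic functions
    and that [Y] consist of analytic ones. Both pairs of spaces qualify, and (1) and (3) meet only
    through (2). The obstacle in (3) is that a locally uniform limit of functions in the unit ball
    of H^0_nu may leave H^0_nu: only the norm bound survives. That the image of the limit lies in
    [Y] must therefore come from (2). Montel's theorem is reached without equicontinuity: Taylor
    coefficients are bounded sequences of numbers, and a function bounded on a circle is small on a
    smaller disc as soon as finitely many of its coefficients are small. Analyticity of f' and of
    locally uniform limits both rest on explicit quadratic remainders obtained from Cauchy's
    formula. *)

Notation RInt_C := (@RInt C_R_CompleteNormedModule).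

(** * Continuity and derivatives along an embedding into C *)

(* Taking [i] to be the identity of [C] or the inclusion [RtoC] treats complex derivatives and
   derivatives of curves at once. *)
Definition cont_at {T : Type} (i : T -> C) (h : T -> C) (t : T) : Prop :=
  forall eps : R, 0 < eps -> exists d : R, 0 < d /\
    forall u, Cmod (i u - i t) < d -> Cmod (h u - h t) < eps.

(* Caratheodory's form of the derivative. *)
Definition der_at {T : Type} (i : T -> C) (h : T -> C) (t : T) (l : C) : Prop :=
  exists q : T -> C, cont_at i q t /\ q t = l /\
    forall u, (h u = h t + q u * (i u - i t))%C.

Definition idC (z : C) : C := z.

Lemma Cmod_minus_sym (a b : C) : Cmod (a - b) = Cmod (b - a).
Proof. rewrite <- Cmod_opp. f_equal. ring. Qed.

Lemma Cmod_sub_le (a b : C) : Cmod (a - b) <= Cmod a + Cmod b.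
Proof. rewrite <- (Cmod_opp b). apply Cmod_triangle. Qed.

Lemma Cmod_sub_ge (a b : C) : Cmod a - Cmod b <= Cmod (a - b).
Proof.
  assert (H := Cmod_triangle (a - b) b).
  replace (a - b + b)%C with a in H by ring. lra.
Qed.

Lemma Cmod_neq0 (a : C) : 0 < Cmod a -> a <> 0%C.
Proof. intros H E. rewrite E, Cmod_0 in H. lra. Qed.

Section Rules.
Context {T : Type} (i : T -> C).

Lemma cont_const (c : C) t : cont_at i (fun _ => c) t.
Proof.
  intros eps He. exists 1. split; [lra|]. intros u _.
  replace (c - c)%C with (RtoC 0) by ring. rewrite Cmod_0. lra.
Qed.

Lemma cont_emb t : cont_at i i t.
Proof. intros eps He. exists eps. auto. Qed.

Lemma cont_ext h k t : (forall u, h u = k u) -> cont_at i h t -> cont_at i k t.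
Proof.
  intros E H eps He. destruct (H eps He) as (d & Hd & K).
  exists d. split; auto. intros u Hu. rewrite <- !E. auto.
Qed.

Lemma cont_plus h k t : cont_at i h t -> cont_at i k t -> cont_at i (fun u => h u + k u)%C t.
Proof.
  intros H K eps He.
  destruct (H (eps / 2)) as (d1 & Hd1 & H1); [lra|].
  destruct (K (eps / 2)) as (d2 & Hd2 & H2); [lra|].
  exists (Rmin d1 d2). split; [apply Rmin_pos; auto|]. intros u Hu.
  assert (A := H1 u (Rlt_le_trans _ _ _ Hu (Rmin_l _ _))).
  assert (B := H2 u (Rlt_le_trans _ _ _ Hu (Rmin_r _ _))).
  replace (h u + k u - (h t + k t))%C with ((h u - h t) + (k u - k t))%C by ring.
  assert (X := Cmod_triangle (h u - h t) (k u - k t)). lra.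
Qed.

Lemma cont_mult h k t : cont_at i h t -> cont_at i k t -> cont_at i (fun u => h u * k u)%C t.
Proof.
  intros H K eps He.
  set (M := 1 + Cmod (h t) + Cmod (k t)).
  assert (Ph := Cmod_ge_0 (h t)). assert (Pk := Cmod_ge_0 (k t)).
  assert (HM : 1 <= M) by (unfold M; lra).
  assert (He' : 0 < Rmin 1 (eps / (2 * M))).
  { apply Rmin_pos; [lra|]. apply Rdiv_lt_0_compat; lra. }
  destruct (H _ He') as (d1 & Hd1 & H1).
  destruct (K _ He') as (d2 & Hd2 & H2).
  exists (Rmin d1 d2). split; [apply Rmin_pos; auto|]. intros u Hu.
  assert (A := H1 u (Rlt_le_trans _ _ _ Hu (Rmin_l _ _))).
  assert (B := H2 u (Rlt_le_trans _ _ _ Hu (Rmin_r _ _))).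
  replace (h u * k u - (h t * k t))%C
    with ((h u - h t) * (k u - k t) + (h u - h t) * k t + h t * (k u - k t))%C by ring.
  assert (X := Cmod_triangle ((h u - h t) * (k u - k t) + (h u - h t) * k t) (h t * (k u - k t))).
  assert (Y := Cmod_triangle ((h u - h t) * (k u - k t)) ((h u - h t) * k t)).
  rewrite Cmod_mult in X. rewrite (Cmod_mult (h u - h t)), (Cmod_mult (h u - h t) (k t)) in Y.
  assert (P1 := Cmod_ge_0 (h u - h t)). assert (P2 := Cmod_ge_0 (k u - k t)).
  set (a := Cmod (h u - h t)) in *. set (b := Cmod (k u - k t)) in *.
  assert (A1 := Rlt_le_trans _ _ _ A (Rmin_r _ _)).
  assert (B1 := Rlt_le_trans _ _ _ B (Rmin_r _ _)).
  assert (B2 := Rlt_le_trans _ _ _ B (Rmin_l _ _)).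
  set (e := eps / (2 * M)) in *.
  assert (E : eps = 2 * M * e) by (unfold e; field; lra).
  assert (a * b <= a) by nra.
  assert (a * Cmod (k t) <= e * Cmod (k t)) by nra.
  assert (Cmod (h t) * b <= Cmod (h t) * e) by nra.
  assert (0 < e) by lra.
  assert (0 <= Cmod (h t) * e) by (apply Rmult_le_pos; lra).
  assert (0 <= Cmod (k t) * e) by (apply Rmult_le_pos; lra).
  rewrite E. unfold M. lra.
Qed.

Lemma cont_inv h t : cont_at i h t -> h t <> 0%C -> cont_at i (fun u => / h u)%C t.
Proof.
  intros H Hn eps He.
  assert (Hp : 0 < Cmod (h t)) by (apply Cmod_gt_0; auto).
  set (m := Cmod (h t)) in *.
  destruct (H (Rmin (m / 2) (eps * m * m / 2))) as (d & Hd & K).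
  { apply Rmin_pos; [lra|]. apply Rmult_lt_0_compat; [|lra]. repeat apply Rmult_lt_0_compat; auto. }
  exists d. split; auto. intros u Hu. specialize (K u Hu).
  assert (K1 := Rlt_le_trans _ _ _ K (Rmin_l _ _)).
  assert (K2 := Rlt_le_trans _ _ _ K (Rmin_r _ _)).
  assert (G : m / 2 < Cmod (h u)).
  { assert (X := Cmod_sub_ge (h t) (h u)). rewrite Cmod_minus_sym in X. fold m in X. lra. }
  assert (Hu0 : h u <> 0%C) by (apply Cmod_neq0; lra).
  replace (/ h u - / h t)%C with (- (h u - h t) / (h u * h t))%C by (field; auto).
  rewrite Cmod_div by (apply Cmult_neq_0; auto).
  rewrite Cmod_opp, Cmod_mult. fold m.
  apply Rmult_lt_reg_r with (Cmod (h u) * m); [apply Rmult_lt_0_compat; lra|].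
  unfold Rdiv. rewrite Rmult_assoc, Rinv_l, Rmult_1_r.
  - apply Rlt_le_trans with (1 := K2).
    assert (0 < eps * m) by (apply Rmult_lt_0_compat; auto).
    nra.
  - apply Rgt_not_eq, Rmult_lt_0_compat; lra.
Qed.

Lemma der_const (c : C) t : der_at i (fun _ => c) t 0.
Proof. exists (fun _ => RtoC 0). split; [apply cont_const|]. split; auto. intros. ring. Qed.

Lemma der_emb t : der_at i i t 1.
Proof. exists (fun _ => RtoC 1). split; [apply cont_const|]. split; auto. intros. ring. Qed.

Lemma der_cont h t l : der_at i h t l -> cont_at i h t.
Proof.
  intros (q & Hq & _ & E).
  apply cont_ext with (fun u => h t + q u * (i u + - i t))%C.
  - intros u. rewrite (E u). unfold Cminus. ring.
  - apply cont_plus; [apply cont_const|]. apply cont_mult; auto.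
    apply cont_plus; [apply cont_emb|apply cont_const].
Qed.

Lemma der_ext h k t l : (forall u, h u = k u) -> der_at i h t l -> der_at i k t l.
Proof. intros E (q & A & B & D). exists q. repeat split; auto. intros u. rewrite <- !E. auto. Qed.

Lemma der_eq h t l m : der_at i h t l -> l = m -> der_at i h t m.
Proof. intros H <-. exact H. Qed.

Lemma der_plus h k t l m :
  der_at i h t l -> der_at i k t m -> der_at i (fun u => h u + k u)%C t (l + m).
Proof.
  intros (q & Hq & Eq & E) (r & Hr & Er & F).
  exists (fun u => q u + r u)%C. split; [apply cont_plus; auto|].
  split; [congruence|]. intros u. rewrite (E u), (F u). ring.
Qed.

Lemma der_mult h k t l m :
  der_at i h t l -> der_at i k t m -> der_at i (fun u => h u * k u)%C t (l * k t + h t * m).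
Proof.
  intros H (r & Hr & Er & F). assert (Hc := der_cont _ _ _ H). destruct H as (q & Hq & Eq & E).
  exists (fun u => q u * k t + h u * r u)%C. split.
  - apply cont_plus; apply cont_mult; auto using cont_const.
  - split; [congruence|]. intros u. rewrite (F u), (E u). ring.
Qed.

Lemma der_scal (c : C) h t l : der_at i h t l -> der_at i (fun u => c * h u)%C t (c * l).
Proof.
  intros H. replace (c * l)%C with (0 * h t + c * l)%C by ring.
  apply (der_mult (fun _ => c)); auto using der_const.
Qed.

Lemma der_minus h k t l m :
  der_at i h t l -> der_at i k t m -> der_at i (fun u => h u - k u)%C t (l - m).
Proof.
  intros H K. replace (l - m)%C with (l + (- (1)) * m)%C by ring.
  apply der_ext with (fun u => h u + (- (1)) * k u)%C.
  - intros. ring.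
  - apply der_plus; auto. apply der_scal; auto.
Qed.

Lemma der_inv h t l :
  der_at i h t l -> h t <> 0%C -> der_at i (fun u => / h u)%C t (- l / (h t * h t)).
Proof.
  intros H Hn. assert (Hc := cont_inv _ _ (der_cont _ _ _ H) Hn).
  destruct H as (q & Hq & Eq & E).
  (* At the zeros of [h] the quotient is defined by solving [/ 0 = 0 = / h t + r u * (i u - i t)]. *)
  exists (fun u => - q u * / h u * / h t +
           (if Ceq_dec (h u) 0 then - / h t / (i u - i t) else 0))%C.
  split; [|split].
  - apply cont_plus.
    + apply cont_mult; [|apply cont_const]. apply cont_mult; auto.
      apply cont_ext with (fun u => (- (1)) * q u)%C; [intros; ring|].
      apply cont_mult; auto using cont_const.
    + intros eps He.
      assert (Hp : 0 < Cmod (h t)) by (apply Cmod_gt_0; auto).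
      assert (Hh : cont_at i h t) by (apply der_cont with l; exists q; auto).
      destruct (Hh _ Hp) as (d & Hd & K). exists d. split; auto. intros u Hu.
      destruct (Ceq_dec (h t) 0) as [E0|_]; [contradiction|].
      destruct (Ceq_dec (h u) 0) as [E0|_].
      * specialize (K u Hu). rewrite E0 in K.
        replace (0 - h t)%C with (- h t)%C in K by ring. rewrite Cmod_opp in K. lra.
      * replace (0 - 0)%C with (RtoC 0) by ring. rewrite Cmod_0. auto.
  - destruct (Ceq_dec (h t) 0) as [E0|_]; [contradiction|]. rewrite Eq. field. auto.
  - intros u. destruct (Ceq_dec (h u) 0) as [E0|N0].
    + assert (D : (i u - i t <> 0)%C).
      { intros D. rewrite (E u), D in E0. apply Hn. rewrite <- E0. ring. }
      rewrite E0. assert (I0 : (/ 0)%C = 0%C).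
      { unfold Cinv; simpl. apply injective_projections; simpl; unfold Rdiv; ring. }
      rewrite I0. field. auto.
    + assert (X : (q u * (i u - i t) = h u - h t)%C) by (rewrite (E u); ring).
      replace (/ h t + (- q u * / h u * / h t + 0) * (i u - i t))%C
        with (/ h t - (q u * (i u - i t)) * / h u * / h t)%C by ring.
      rewrite X. field. auto.
Qed.

Lemma der_pow h t l n : der_at i h t l ->
  der_at i (fun u => h u ^ S n)%C t (INR (S n) * h t ^ n * l).
Proof.
  intros H. induction n as [|n IH].
  - apply der_ext with h; [intros; rewrite Cpow_1_r; auto|].
    simpl. replace (1 * 1 * l)%C with l by ring. auto.
  - replace (INR (S (S n)) * h t ^ S n * l)%C
      with (l * h t ^ S n + h t * (INR (S n) * h t ^ n * l))%C.
    + apply der_ext with (fun u => h u * h u ^ S n)%C; [intros; rewrite (Cpow_S _ (S n)); auto|].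
      apply der_mult; auto.
    + rewrite (S_INR (S n)), RtoC_plus, Cpow_S. ring.
Qed.

Lemma cont_comp F w t : cont_at idC F (w t) -> cont_at i w t -> cont_at i (fun u => F (w u)) t.
Proof.
  intros H K eps He. destruct (H eps He) as (d & Hd & A).
  destruct (K d Hd) as (d' & Hd' & B). exists d'. split; auto. intros u Hu. apply A, B, Hu.
Qed.

Lemma der_comp F w t L l :
  der_at idC F (w t) L -> der_at i w t l -> der_at i (fun u => F (w u)) t (L * l).
Proof.
  intros (q & Hq & Eq & E) Hw. assert (Hc := der_cont _ _ _ Hw). destruct Hw as (r & Hr & Er & G).
  exists (fun u => q (w u) * r u)%C. split; [|split].
  - apply cont_mult; auto. apply cont_comp; auto.
  - congruence.
  - intros u. rewrite (E (w u)). unfold idC. rewrite (G u) at 2. ring.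
Qed.

Lemma der_little_o h t l : der_at i h t l ->
  forall eps, 0 < eps -> exists d, 0 < d /\ forall u, Cmod (i u - i t) < d ->
    Cmod (h u - h t - l * (i u - i t)) <= eps * Cmod (i u - i t).
Proof.
  intros (q & Hq & Eq & E) eps He. destruct (Hq eps He) as (d & Hd & K).
  exists d. split; auto. intros u Hu. specialize (K u Hu). rewrite (E u), <- Eq.
  replace (h t + q u * (i u - i t) - h t - q t * (i u - i t))%C
    with ((q u - q t) * (i u - i t))%C by ring.
  rewrite Cmod_mult. apply Rmult_le_compat_r; [apply Cmod_ge_0|lra].
Qed.

(** The difference quotient, completed by the value [l] wherever [i u = i t], serves as the
    Caratheodory quotient. *)
Lemma little_o_der h t l :
  (forall u, i u = i t -> h u = h t) ->
  (forall eps, 0 < eps -> exists d, 0 < d /\ forall u, Cmod (i u - i t) < d ->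
    Cmod (h u - h t - l * (i u - i t)) <= eps * Cmod (i u - i t)) ->
  der_at i h t l.
Proof.
  intros Hi H.
  exists (fun u => if Ceq_dec (i u) (i t) then l else ((h u - h t) / (i u - i t))%C).
  split; [|split].
  - intros eps He. destruct (H (eps / 2)) as (d & Hd & K); [lra|].
    exists d. split; auto. intros u Hu. specialize (K u Hu).
    destruct (Ceq_dec (i t) (i t)) as [_|N]; [|congruence].
    destruct (Ceq_dec (i u) (i t)) as [_|N].
    + replace (l - l)%C with (RtoC 0) by ring. rewrite Cmod_0. auto.
    + assert (D : (i u - i t <> 0)%C) by (intros D; apply N; rewrite <- (Cplus_0_l (i t)), <- D; ring).
      assert (P := proj1 (Cmod_gt_0 _) D).
      replace ((h u - h t) / (i u - i t) - l)%C
        with ((h u - h t - l * (i u - i t)) / (i u - i t))%C by (field; auto).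
      rewrite Cmod_div by auto.
      apply Rle_lt_trans with (eps / 2); [|lra].
      apply Rmult_le_reg_r with (1 := P). unfold Rdiv at 1.
      rewrite Rmult_assoc, Rinv_l, Rmult_1_r by lra. auto.
  - destruct (Ceq_dec (i t) (i t)) as [_|N]; [auto|congruence].
  - intros u. destruct (Ceq_dec (i u) (i t)) as [E|N].
    + rewrite (Hi u E), E. ring.
    + assert (D : (i u - i t <> 0)%C) by (intros D; apply N; rewrite <- (Cplus_0_l (i t)), <- D; ring).
      field. auto.
Qed.

End Rules.

Lemma der_is_derive f z l :
  der_at idC f z l <-> @is_derive C_AbsRing C_NormedModule f z l.
Proof.
  split.
  - intros H. split; [apply is_linear_scal_l|].
    intros x Hx. assert (E := is_filter_lim_locally_unique _ _ Hx). subst x.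
    intros eps. destruct (der_little_o idC f z l H eps (cond_pos eps)) as (d & Hd & K).
    exists (mkposreal d Hd). intros y Hy. specialize (K y Hy).
    rewrite (Cmult_comm l) in K. exact K.
  - intros [_ H]. specialize (H z (fun P HP => HP)).
    apply little_o_der; [unfold idC; intros; subst; auto|].
    intros eps He. destruct (H (mkposreal eps He)) as (d & K).
    exists d. split; [apply cond_pos|]. intros u Hu. specialize (K u Hu).
    rewrite Cmult_comm. exact K.
Qed.

Lemma dC_eq f z l : der_at idC f z l -> dC f z = l.
Proof. intros H. apply is_C_derive_unique, der_is_derive, H. Qed.

Lemma holoD_der f z : holoD f -> inD z -> der_at idC f z (dC f z).
Proof. intros H Hz. apply der_is_derive, (C_derive_correct f z 0%C), H, Hz. Qed.

Lemma der_holoD f f' : (forall z, inD z -> der_at idC f z (f' z)) -> holoD f.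
Proof. intros H z Hz. exists (f' z). apply der_is_derive, H, Hz. Qed.

(** * Integrals of complex-valued functions of a real variable *)

Notation cont_R := (cont_at RtoC).
Notation der_R := (der_at RtoC).
Notation is_RInt_C := (@is_RInt C_R_NormedModule).

Lemma cont_R_continuous h t :
  cont_R h t -> @continuous R_UniformSpace C_R_NormedModule h t.
Proof.
  intros H P [eps HP]. destruct (H eps (cond_pos eps)) as (d & Hd & K).
  exists (mkposreal d Hd). intros u Hu. apply HP.
  apply C_NormedModule_mixin_compat1. apply K.
  rewrite <- RtoC_minus, Cmod_R. exact Hu.
Qed.

Lemma der_R_is_derive h t l :
  der_R h t l -> @is_derive R_AbsRing C_R_NormedModule h t l.
Proof.
  intros H. split; [apply is_linear_scal_l|].
  intros x Hx. assert (E := is_filter_lim_locally_unique _ _ Hx). subst x.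
  intros eps. destruct (der_little_o RtoC h t l H eps (cond_pos eps)) as (d & Hd & K).
  exists (mkposreal d Hd). intros u Hu.
  specialize (K u). rewrite <- RtoC_minus, (Cmod_R (u - t)) in K.
  specialize (K Hu). rewrite <- Cmod_norm.
  match goal with |- Cmod ?x <= _ =>
    replace x with (h u - h t - l * RtoC (u - t))%C; [exact K|] end.
  apply injective_projections; simpl; unfold minus, plus, opp, scal, mult; simpl;
    unfold mult; simpl; ring.
Qed.

Lemma ex_RInt_cont h a b : a <= b -> (forall t, a <= t <= b -> cont_R h t) ->
  is_RInt_C h a b (RInt_C h a b).
Proof.
  intros Hab H. apply (@RInt_correct C_R_CompleteNormedModule), ex_RInt_continuous.
  intros t Ht. rewrite Rmin_left, Rmax_right in Ht by auto. apply cont_R_continuous, H, Ht.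
Qed.

Lemma RInt_C_unique h a b l : is_RInt_C h a b l -> RInt_C h a b = l.
Proof. apply (@is_RInt_unique C_R_CompleteNormedModule). Qed.

(** The integral is taken in a real normed module, so a complex factor has to be treated through
    real and imaginary parts. *)
Lemma is_RInt_C_scal (c : C) h a b l :
  is_RInt_C h a b l -> is_RInt_C (fun t => c * h t)%C a b (c * l)%C.
Proof.
  intros H.
  assert (H1 := is_RInt_fct_extend_fst h a b l H).
  assert (H2 := is_RInt_fct_extend_snd h a b l H).
  apply (is_RInt_fct_extend_pair (fun t => (c * h t)%C)); simpl.
  - apply (@is_RInt_minus R_NormedModule (fun t => fst c * fst (h t)) (fun t => snd c * snd (h t)));
      apply (@is_RInt_scal R_NormedModule); auto.
  - apply (@is_RInt_plus R_NormedModule (fun t => fst c * snd (h t)) (fun t => snd c * fst (h t)));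
      apply (@is_RInt_scal R_NormedModule); auto.
Qed.

Lemma is_RInt_C_minus h k a b l m : is_RInt_C h a b l -> is_RInt_C k a b m ->
  is_RInt_C (fun t => h t - k t)%C a b (l - m)%C.
Proof. apply (@is_RInt_minus C_R_NormedModule). Qed.

Lemma is_RInt_C_ext h k a b l : a <= b -> (forall t, a <= t <= b -> h t = k t) ->
  is_RInt_C h a b l -> is_RInt_C k a b l.
Proof.
  intros Hab E. apply is_RInt_ext. intros t Ht.
  rewrite Rmin_left, Rmax_right in Ht by auto. apply E. lra.
Qed.

Lemma is_RInt_C_bound h a b l M : a <= b ->
  (forall t, a <= t <= b -> Cmod (h t) <= M) -> is_RInt_C h a b l -> Cmod l <= (b - a) * M.
Proof.
  intros Hab HM H. rewrite Cmod_norm.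
  apply (norm_RInt_le_const h a b l M Hab); auto.
  intros t Ht. rewrite <- Cmod_norm. auto.
Qed.

Lemma is_RInt_C_const a b c : is_RInt_C (fun _ => c) a b ((b - a)%R * c)%C.
Proof.
  replace (RtoC (b - a) * c)%C with (@scal R_Ring C_R_NormedModule (b - a) c).
  - apply (@is_RInt_const C_R_NormedModule).
  - apply injective_projections; simpl; unfold scal, mult; simpl; unfold mult; simpl; ring.
Qed.

Lemma is_RInt_C_FTC h h' a b : a <= b ->
  (forall t, a <= t <= b -> der_R h t (h' t)) ->
  (forall t, a <= t <= b -> cont_R h' t) ->
  is_RInt_C h' a b (h b - h a)%C.
Proof.
  intros Hab H K. apply (@is_RInt_derive C_R_CompleteNormedModule); intros t Ht;
    rewrite Rmin_left, Rmax_right in Ht by auto.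
  - apply der_R_is_derive, H, Ht.
  - apply cont_R_continuous, K, Ht.
Qed.

Lemma RInt_C_Chasles h a b c : a <= b -> b <= c -> (forall t, a <= t <= c -> cont_R h t) ->
  (RInt_C h a c = RInt_C h a b + RInt_C h b c)%C.
Proof.
  intros Hab Hbc H. symmetry.
  apply (@RInt_Chasles C_R_CompleteNormedModule);
    eexists; apply ex_RInt_cont; auto; intros; apply H; lra.
Qed.

(** * Goursat's theorem for parametrised squares *)

Lemma pow_half_pos n : 0 < (1 / 2) ^ n.
Proof. apply pow_lt; lra. Qed.

Lemma pow_half_small eps : 0 < eps -> exists n, (1 / 2) ^ n < eps.
Proof.
  intros He. destruct (pow_lt_1_zero (1 / 2)) with (y := eps) as [N HN]; auto.
  - rewrite Rabs_right; lra.
  - exists N. specialize (HN N (le_n N)). rewrite Rabs_right in HN; auto.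
    apply Rle_ge, Rlt_le, pow_half_pos.
Qed.

(** The left endpoints increase while the right endpoints [a n + (1 / 2) ^ n] decrease, so the
    supremum of the former lies in every interval. *)
Lemma nested_dyadic (a : nat -> R) :
  (forall n, a n <= a (S n) <= a n + (1 / 2) ^ S n) ->
  exists x, forall n, a n <= x <= a n + (1 / 2) ^ n.
Proof.
  intros H.
  assert (G : forall n m, a n <= a (n + m)%nat <= a n + (1 / 2) ^ n - (1 / 2) ^ (n + m)).
  { intros n m. induction m as [|m IH].
    - rewrite Nat.add_0_r. lra.
    - rewrite Nat.add_succ_r. specialize (H (n + m)%nat). simpl in *. lra. }
  destruct (completeness (fun y => exists n, y = a n)) as [x [Hx Hx']].
  - exists (a 0%nat + 1). intros y [n ->]. specialize (G 0%nat n). simpl in G.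
    assert (X := pow_half_pos n). simpl in *. lra.
  - exists (a 0%nat), 0%nat. auto.
  - exists x. intros n. split.
    + apply Hx. eauto.
    + apply Hx'. intros y [m ->].
      destruct (le_lt_dec n m) as [L|L].
      * specialize (G n (m - n)%nat). replace (n + (m - n))%nat with m in G by lia.
        assert (X := pow_half_pos m). lra.
      * specialize (G m (n - m)%nat). replace (m + (n - m))%nat with n in G by lia.
        assert (X := pow_half_pos n). lra.
Qed.

Section Bisection.

(* [P a c h] is a quantity attached to the square [a, a+h] x [c, c+h]. *)
Variable P : R -> R -> R -> C.

Hypothesis P_split : forall a c h, 0 <= a -> 0 <= c -> 0 < h -> a + h <= 1 -> c + h <= 1 ->
  P a c h = (P a c (h / 2) + P (a + h / 2) c (h / 2) + P a (c + h / 2) (h / 2)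
             + P (a + h / 2) (c + h / 2) (h / 2))%C.

Hypothesis P_small : forall x y eps, 0 <= x <= 1 -> 0 <= y <= 1 -> 0 < eps ->
  exists d, 0 < d /\ forall a c h, 0 < h < d -> 0 <= a -> 0 <= c -> a + h <= 1 -> c + h <= 1 ->
    a <= x <= a + h -> c <= y <= c + h -> Cmod (P a c h) <= eps * h ^ 2.

Lemma bisection_step (eta : R) (p : R * R) h :
  0 <= fst p -> 0 <= snd p -> 0 < h -> fst p + h <= 1 -> snd p + h <= 1 ->
  eta <= Cmod (P (fst p) (snd p) h) ->
  exists q : R * R, fst p <= fst q <= fst p + h / 2 /\ snd p <= snd q <= snd p + h / 2 /\
    eta / 4 <= Cmod (P (fst q) (snd q) (h / 2)).
Proof.
  destruct p as [a c]; simpl. intros Ha Hc Hh Ha' Hc' H.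
  apply NNPP. intros N.
  assert (G : forall x y, a <= x <= a + h / 2 -> c <= y <= c + h / 2 ->
    Cmod (P x y (h / 2)) < eta / 4).
  { intros x y Hx Hy. apply Rnot_le_lt. intros L. apply N. exists (x, y). auto. }
  rewrite (P_split a c h) in H by auto.
  assert (G1 := G a c). assert (G2 := G (a + h / 2) c).
  assert (G3 := G a (c + h / 2)). assert (G4 := G (a + h / 2) (c + h / 2)).
  assert (T1 := Cmod_triangle (P a c (h / 2) + P (a + h / 2) c (h / 2) + P a (c + h / 2) (h / 2))
             (P (a + h / 2) (c + h / 2) (h / 2))).
  assert (T2 := Cmod_triangle (P a c (h / 2) + P (a + h / 2) c (h / 2)) (P a (c + h / 2) (h / 2))).
  assert (T3 := Cmod_triangle (P a c (h / 2)) (P (a + h / 2) c (h / 2))).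
  lra.
Qed.

(** Some subsquare keeps at least a quarter of the modulus, which is exactly the rate at which
    [h ^ 2] shrinks. Hence [eta * h ^ 2 <= Cmod (P a c h)] along the nested squares, against
    [P_small] with [eta / 2] at their common point. *)
Lemma bisection_zero : P 0 0 1 = 0%C.
Proof.
  apply NNPP. intros N. assert (Hp : 0 < Cmod (P 0 0 1)) by (apply Cmod_gt_0; auto).
  set (eta := Cmod (P 0 0 1)) in *.
  set (good := fun n (p : R * R) => 0 <= fst p /\ 0 <= snd p /\
    fst p + (1 / 2) ^ n <= 1 /\ snd p + (1 / 2) ^ n <= 1 /\
    eta / 4 ^ n <= Cmod (P (fst p) (snd p) ((1 / 2) ^ n))).
  assert (step : forall np : nat * (R * R), exists q : R * R, good (fst np) (snd np) ->
    good (S (fst np)) q /\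
    fst (snd np) <= fst q <= fst (snd np) + (1 / 2) ^ S (fst np) /\
    snd (snd np) <= snd q <= snd (snd np) + (1 / 2) ^ S (fst np)).
  { intros [n p]. simpl fst; simpl snd.
    (* [functional_choice] wants a total relation: off the good squares any value will do. *)
    destruct (classic (good n p)) as [G|G]; [|exists (0, 0); tauto].
    destruct G as (G1 & G2 & G3 & G4 & G5).
    destruct (bisection_step (eta / 4 ^ n) p ((1 / 2) ^ n)) as (q & Q1 & Q2 & Q3); auto.
    { apply pow_half_pos. }
    replace ((1 / 2) ^ n / 2) with ((1 / 2) ^ S n) in * by (simpl; field).
    exists q. intros _. split; [|split]; auto.
    assert (E : (1 / 2) ^ n = 2 * (1 / 2) ^ S n) by (simpl; field).
    unfold good. repeat split; try lra.
    replace (eta / 4 ^ S n) with (eta / 4 ^ n / 4); auto.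
    simpl. field. apply pow_nonzero. lra. }
  apply functional_choice in step. destruct step as [f Hf].
  set (p := fix p n := match n with O => (0, 0) | S m => f (m, p m) end).
  assert (Hgood : forall n, good n (p n)).
  { induction n as [|n IH].
    - unfold good; simpl. fold eta. repeat split; lra.
    - apply (Hf (n, p n)), IH. }
  destruct (nested_dyadic (fun n => fst (p n))) as [x Hx].
  { intros n. apply (Hf (n, p n)), Hgood. }
  destruct (nested_dyadic (fun n => snd (p n))) as [y Hy].
  { intros n. apply (Hf (n, p n)), Hgood. }
  assert (X0 := Hx 0%nat). assert (Y0 := Hy 0%nat). simpl in X0, Y0.
  destruct (P_small x y (eta / 2)) as (d & Hd & K); try lra.
  destruct (pow_half_small d Hd) as [n Hn].
  destruct (Hgood n) as (G1 & G2 & G3 & G4 & G5).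
  specialize (K (fst (p n)) (snd (p n)) ((1 / 2) ^ n) (conj (pow_half_pos n) Hn)
    G1 G2 G3 G4 (Hx n) (Hy n)).
  assert (E : eta / 4 ^ n = eta * ((1 / 2) ^ n) ^ 2).
  { rewrite <- pow_mult, Nat.mul_comm, pow_mult.
    replace ((1 / 2) ^ 2) with (/ 4) by (simpl; field). rewrite pow_inv. reflexivity. }
  rewrite E in G5. assert (Q := pow_half_pos n).
  assert (0 < ((1 / 2) ^ n) ^ 2) by (apply pow_lt; auto).
  nra.
Qed.

End Bisection.

Lemma cont_curve F w w' t l m : der_at idC F (w t) l -> der_R w t m -> cont_R w' t ->
  cont_R (fun t => F (w t) * w' t)%C t.
Proof.
  intros HF Hw Hw'. apply cont_mult; auto.
  apply cont_comp; eapply der_cont; eassumption.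
Qed.

(** Replacing [F] by a function [A] with primitive [G] turns the integral into an increment of [G],
    and increments cancel around a closed contour; only the error [F - A] along the path remains. *)
Lemma path_integral_defect F A G w w' p q L M : p <= q -> 0 <= M ->
  (forall t, p <= t <= q -> exists l, der_at idC F (w t) l) ->
  (forall t, p <= t <= q -> der_R w t (w' t)) ->
  (forall t, p <= t <= q -> cont_R w' t) ->
  (forall t, p <= t <= q -> Cmod (w' t) <= L) ->
  (forall u, exists l, der_at idC A u l) ->
  (forall u, der_at idC G u (A u)) ->
  (forall t, p <= t <= q -> Cmod (F (w t) - A (w t)) <= M) ->
  Cmod (RInt_C (fun t => F (w t) * w' t)%C p q - (G (w q) - G (w p))) <= (q - p) * (M * L).
Proof.
  intros Hpq HM HF Hw Hc HL HA HG HE.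
  assert (K : is_RInt_C (fun t => A (w t) * w' t)%C p q (G (w q) - G (w p))%C).
  { apply (is_RInt_C_FTC (fun t => G (w t))); auto.
    - intros t Ht. apply der_comp; auto.
    - intros t Ht. destruct (HA (w t)) as [l Hl]. eapply cont_curve; eauto. }
  eapply is_RInt_C_bound; auto; [|apply is_RInt_C_minus; [apply ex_RInt_cont; auto|exact K]].
  - intros t Ht. simpl.
    replace (F (w t) * w' t - A (w t) * w' t)%C with ((F (w t) - A (w t)) * w' t)%C by ring.
    rewrite Cmod_mult. apply Rmult_le_compat; auto using Cmod_ge_0.
  - intros t Ht. destruct (HF t Ht) as [l Hl]. eapply cont_curve; eauto.
Qed.

Lemma curve_lipschitz w w' p q L : p <= q ->
  (forall t, p <= t <= q -> der_R w t (w' t)) ->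
  (forall t, p <= t <= q -> cont_R w' t) ->
  (forall t, p <= t <= q -> Cmod (w' t) <= L) ->
  Cmod (w q - w p) <= (q - p) * L.
Proof.
  intros Hpq Hw Hc HL. eapply is_RInt_C_bound; eauto. apply is_RInt_C_FTC; auto.
Qed.

Section Goursat.

Variables (F : C -> C) (w ws wt : R -> R -> C) (L : R).
Hypothesis L_pos : 0 < L.
Let I01 s := 0 <= s <= 1.
Hypothesis w_s : forall s t, I01 s -> I01 t -> der_R (fun s => w s t) s (ws s t).
Hypothesis w_t : forall s t, I01 s -> I01 t -> der_R (fun t => w s t) t (wt s t).
Hypothesis ws_cont : forall s t, I01 s -> I01 t -> cont_R (fun s => ws s t) s.
Hypothesis wt_cont : forall s t, I01 s -> I01 t -> cont_R (fun t => wt s t) t.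
Hypothesis ws_bound : forall s t, I01 s -> I01 t -> Cmod (ws s t) <= L.
Hypothesis wt_bound : forall s t, I01 s -> I01 t -> Cmod (wt s t) <= L.
Hypothesis F_der : forall s t, I01 s -> I01 t -> exists l, der_at idC F (w s t) l.

Let I (t a b : R) : C := RInt_C (fun s => F (w s t) * ws s t)%C a b.
Let J (s c d : R) : C := RInt_C (fun t => F (w s t) * wt s t)%C c d.
(** The integral of [F(w) dw] along the image of the boundary of a square, run counterclockwise in
    the parameters. *)
Let P (a c h : R) : C := (I c a (a + h) + J (a + h) c (c + h) - I (c + h) a (a + h) - J a c (c + h))%C.

Lemma w_lipschitz_s s s' t : I01 s -> I01 s' -> I01 t -> Cmod (w s t - w s' t) <= L * Rabs (s - s').
Proof.
  intros Hs Hs' Ht. destruct (Rle_dec s s') as [H|H].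
  - rewrite Cmod_minus_sym, Rabs_minus_sym, Rabs_right, Rmult_comm by lra.
    apply (curve_lipschitz (fun s => w s t) (fun s => ws s t)); auto; unfold I01 in *; intros;
      [apply w_s|apply ws_cont|apply ws_bound]; unfold I01; lra.
  - rewrite Rabs_right, Rmult_comm by lra.
    apply (curve_lipschitz (fun s => w s t) (fun s => ws s t)); try lra; auto; unfold I01 in *; intros;
      [apply w_s|apply ws_cont|apply ws_bound]; unfold I01; lra.
Qed.

Lemma w_lipschitz_t s t t' : I01 s -> I01 t -> I01 t' -> Cmod (w s t - w s t') <= L * Rabs (t - t').
Proof.
  intros Hs Ht Ht'. destruct (Rle_dec t t') as [H|H].
  - rewrite Cmod_minus_sym, Rabs_minus_sym, Rabs_right, Rmult_comm by lra.
    apply (curve_lipschitz (fun t => w s t) (fun t => wt s t)); auto; unfold I01 in *; intros;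
      [apply w_t|apply wt_cont|apply wt_bound]; unfold I01; lra.
  - rewrite Rabs_right, Rmult_comm by lra.
    apply (curve_lipschitz (fun t => w s t) (fun t => wt s t)); try lra; auto; unfold I01 in *; intros;
      [apply w_t|apply wt_cont|apply wt_bound]; unfold I01; lra.
Qed.

Lemma I_Chasles t a b c : I01 t -> 0 <= a <= b -> b <= c <= 1 -> (I t a c = I t a b + I t b c)%C.
Proof.
  intros Ht Hab Hbc. apply RInt_C_Chasles; try lra. intros s Hs.
  assert (Is : I01 s) by (unfold I01; lra).
  destruct (F_der s t Is Ht) as [l Hl].
  apply (cont_curve F (fun s => w s t) (fun s => ws s t) s l (ws s t)); auto.
Qed.

Lemma J_Chasles s a b c : I01 s -> 0 <= a <= b -> b <= c <= 1 -> (J s a c = J s a b + J s b c)%C.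
Proof.
  intros Hs Hab Hbc. apply RInt_C_Chasles; try lra. intros t Ht.
  assert (It : I01 t) by (unfold I01; lra).
  destruct (F_der s t Hs It) as [l Hl].
  apply (cont_curve F (fun t => w s t) (fun t => wt s t) t l (wt s t)); auto.
Qed.

(** Near the limit point [F] differs from its affine part by [o(h)], since the image of a square of
    side [h] has diameter at most [2 * L * h]. An edge may collapse to a point and two edges may
    share an image, as happens in the two applications. *)
Theorem goursat : (I 0 0 1 + J 1 0 1 - I 1 0 1 - J 0 0 1 = 0)%C.
Proof.
  assert (H : P 0 0 1 = 0%C).
  2: { unfold P in H. rewrite !Rplus_0_l in H. exact H. }
  apply bisection_zero.
  - intros a c h Ha Hc Hh Ha' Hc'. unfold P.
    replace (a + h / 2 + h / 2) with (a + h) by field.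
    replace (c + h / 2 + h / 2) with (c + h) by field.
    rewrite (I_Chasles c a (a + h / 2) (a + h)) by (unfold I01; lra).
    rewrite (I_Chasles (c + h) a (a + h / 2) (a + h)) by (unfold I01; lra).
    rewrite (J_Chasles a c (c + h / 2) (c + h)) by (unfold I01; lra).
    rewrite (J_Chasles (a + h) c (c + h / 2) (c + h)) by (unfold I01; lra).
    ring.
  - intros x y eps Hx Hy He.
    destruct (F_der x y Hx Hy) as [l Hl].
    (* Each of the four edges will contribute at most [2 * e * L ^ 2 * h ^ 2], so this [e] makes the
       total [eps * h ^ 2]. *)
    set (w0 := w x y) in *. set (e := eps / (8 * L * L)).
    assert (He' : 0 < e) by (unfold e; apply Rdiv_lt_0_compat; nra).
    destruct (der_little_o idC F w0 l Hl e He') as (d & Hd & K). unfold idC in K.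
    set (A := fun u : C => (F w0 + l * (u - w0))%C).
    set (G := fun u : C => (F w0 * u + l * / 2 * ((u - w0) * (u - w0)))%C).
    exists (d / (2 * L)). split; [apply Rdiv_lt_0_compat; lra|].
    intros a c h [Hh Hhd] Ha Hc Ha' Hc' Hax Hcy.
    assert (HA : forall u, der_at idC A u l).
    { intros u. replace l with (0 + l * (1 - 0))%C by ring.
      apply der_plus; [apply der_const|]. apply der_scal, der_minus; [apply der_emb|apply der_const]. }
    assert (HA' : forall u, exists m, der_at idC A u m) by (intros u; exists l; apply HA).
    assert (HG : forall u, der_at idC G u (A u)).
    { intros u. unfold A.
      replace (F w0 + l * (u - w0))%C
        with (F w0 * 1 + l * / 2 * ((1 - 0) * (u - w0) + (u - w0) * (1 - 0)))%C.
      - apply der_plus; [apply der_scal, der_emb|]. apply der_scal.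
        apply (der_mult idC (fun u => u - w0)%C (fun u => u - w0)%C);
          apply der_minus; auto using der_const; apply der_emb.
      - field. }
    assert (HM : forall s t, a <= s <= a + h -> c <= t <= c + h ->
              Cmod (F (w s t) - A (w s t)) <= e * (2 * L * h)).
    { intros s t Hs Ht.
      assert (D : Cmod (w s t - w0) <= 2 * L * h).
      { replace (w s t - w0)%C with ((w s t - w x t) + (w x t - w x y))%C by (unfold w0; ring).
        eapply Rle_trans; [apply Cmod_triangle|].
        assert (B1 : Cmod (w s t - w x t) <= L * Rabs (s - x))
          by (apply w_lipschitz_s; unfold I01; lra).
        assert (B2 : Cmod (w x t - w x y) <= L * Rabs (t - y))
          by (apply w_lipschitz_t; unfold I01; lra).
        assert (Rabs (s - x) <= h) by (apply Rabs_le; lra).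
        assert (Rabs (t - y) <= h) by (apply Rabs_le; lra). nra. }
      assert (D' : Cmod (w s t - w0) < d).
      { apply Rle_lt_trans with (1 := D).
        apply Rmult_lt_reg_r with (/ (2 * L)); [apply Rinv_0_lt_compat; lra|].
        replace (2 * L * h * / (2 * L)) with h by (field; lra). exact Hhd. }
      specialize (K _ D').
      replace (F (w s t) - A (w s t))%C with (F (w s t) - F w0 - l * (w s t - w0))%C
        by (unfold A; ring).
      eapply Rle_trans; [exact K|]. apply Rmult_le_compat_l; lra. }
    assert (HM0 : 0 <= e * (2 * L * h)) by (apply Rmult_le_pos; nra).
    assert (SI : forall t, c <= t <= c + h -> Cmod (I t a (a + h) - (G (w (a + h) t) - G (w a t)))
               <= h * (e * (2 * L * h) * L)).
    { intros t Ht. replace (h * (e * (2 * L * h) * L)) with ((a + h - a) * (e * (2 * L * h) * L)) by ring.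
      apply (path_integral_defect F A G (fun s => w s t) (fun s => ws s t)); auto; try lra; intros s Hs;
        [apply F_der|apply w_s|apply ws_cont|apply ws_bound]; unfold I01; lra. }
    assert (SJ : forall s, a <= s <= a + h -> Cmod (J s c (c + h) - (G (w s (c + h)) - G (w s c)))
               <= h * (e * (2 * L * h) * L)).
    { intros s Hs. replace (h * (e * (2 * L * h) * L)) with ((c + h - c) * (e * (2 * L * h) * L)) by ring.
      apply (path_integral_defect F A G (fun t => w s t) (fun t => wt s t)); auto; try lra; intros t Ht;
        [apply F_der|apply w_t|apply wt_cont|apply wt_bound]; unfold I01; lra. }
    assert (S1 := SI c ltac:(lra)). assert (S2 := SI (c + h) ltac:(lra)).
    assert (S3 := SJ a ltac:(lra)). assert (S4 := SJ (a + h) ltac:(lra)).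
    unfold P.
    set (Z1 := (I c a (a + h) - (G (w (a + h) c) - G (w a c)))%C) in *.
    set (Z2 := (I (c + h) a (a + h) - (G (w (a + h) (c + h)) - G (w a (c + h))))%C) in *.
    set (Z3 := (J a c (c + h) - (G (w a (c + h)) - G (w a c)))%C) in *.
    set (Z4 := (J (a + h) c (c + h) - (G (w (a + h) (c + h)) - G (w (a + h) c)))%C) in *.
    match goal with |- Cmod ?X <= _ => replace X with (Z1 + Z4 - Z2 - Z3)%C
      by (unfold Z1, Z2, Z3, Z4; ring) end.
    assert (T1 := Cmod_sub_le (Z1 + Z4 - Z2) Z3).
    assert (T2 := Cmod_sub_le (Z1 + Z4) Z2). assert (T3 := Cmod_triangle Z1 Z4).
    replace (eps * h ^ 2) with (4 * (h * (e * (2 * L * h) * L))); [lra|].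
    unfold e. field. lra.
Qed.

End Goursat.

(* The codomain of an integrand is displayed as a normed module, which hides the field structure of [C]. *)
Ltac eqC := match goal with |- ?a = ?b => change (@eq C a b) end.

Lemma RInt_C_ext h k a b : a <= b -> (forall t, a <= t <= b -> h t = k t) ->
  RInt_C h a b = RInt_C k a b.
Proof.
  intros Hab E. apply (@RInt_ext C_R_CompleteNormedModule). intros t Ht.
  rewrite Rmin_left, Rmax_right in Ht by auto. apply E. lra.
Qed.

Lemma der_affine (a b : C) t : der_R (fun t => a + t * b)%C t b.
Proof.
  apply der_eq with (0 + (1 * b + t * 0))%C; [|ring].
  apply der_plus; [apply der_const|]. apply (der_mult RtoC RtoC); [apply der_emb|apply der_const].
Qed.

(** * Primitives *)

(** Written so that [Sg g f] is convertible with the [ray_primitive] of the product of [dC f] and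
    [g]. *)
Definition ray_primitive (F : C -> C) (z : C) : C := RInt_C (fun t => F (t * z) * z)%C 0 1.

Lemma segment_inD z u t : inD z -> inD u -> 0 <= t <= 1 -> inD (z + t * (u - z)).
Proof.
  unfold inD. intros Hz Hu Ht.
  replace (z + t * (u - z))%C with (RtoC (1 - t) * z + t * u)%C by (rewrite RtoC_minus; ring).
  eapply Rle_lt_trans; [apply Cmod_triangle|].
  rewrite !Cmod_mult, !Cmod_R, !Rabs_right by lra.
  destruct (Req_dec t 0) as [->|N]; [lra|].
  assert (t * Cmod u < t * 1) by (apply Rmult_lt_compat_l; lra).
  assert ((1 - t) * Cmod z <= (1 - t) * 1) by (apply Rmult_le_compat_l; lra). lra.
Qed.

Lemma scal_inD z s : inD z -> 0 <= s <= 1 -> inD (s * z).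
Proof.
  unfold inD. intros Hz Hs. rewrite Cmod_mult, Cmod_R, Rabs_right by lra.
  assert (X := Cmod_ge_0 z). nra.
Qed.

(** The edge [s = 0] of the parameter square collapses to the origin, so what is left of its
    boundary is the triangle with vertices 0, [z] and [u]. *)
Lemma ray_primitive_increment F z u : holoD F -> inD z -> inD u ->
  is_RInt_C (fun t => F (z + t * (u - z)) * (u - z))%C 0 1 (ray_primitive F u - ray_primitive F z)%C.
Proof.
  intros HF Hz Hu.
  assert (D : forall v, inD v -> exists l, der_at idC F v l).
  { intros v Hv. exists (dC F v). apply holoD_der; auto. }
  assert (Seg := segment_inD z u).
  assert (Hd : forall s t, 0 <= s <= 1 -> 0 <= t <= 1 -> inD (s * (z + t * (u - z))))
    by (intros; apply scal_inD; auto).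
  assert (Duz : Cmod (u - z) <= 2).
  { assert (X := Cmod_sub_le u z). unfold inD in *. lra. }
  assert (G := goursat F (fun s t => s * (z + t * (u - z)))%C (fun s t => z + t * (u - z))%C
    (fun s t => s * (u - z))%C 2).
  simpl in G.
  assert (E : (ray_primitive F z + RInt_C (fun t => F (z + t * (u - z)) * (u - z))%C 0 1
     - ray_primitive F u - 0 = 0)%C).
  { match type of G with _ -> _ -> _ -> _ -> _ -> _ -> _ -> _ -> ?e = _ =>
      transitivity e; [clear G|apply G; clear G] end.
    - f_equal; [f_equal; [f_equal|]|].
      + apply RInt_C_ext; [lra|]. intros s Hs.
        replace (z + 0%R * (u - z))%C with z by ring. reflexivity.
      + apply RInt_C_ext; [lra|]. intros t Ht.
        rewrite !Cmult_1_l. reflexivity.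
      + apply RInt_C_ext; [lra|]. intros s Hs.
        replace (z + 1%R * (u - z))%C with u by ring. reflexivity.
      + rewrite (RInt_C_ext _ (fun _ => RtoC 0)); [|lra|].
        * rewrite (RInt_C_unique _ _ _ _ (is_RInt_C_const 0 1 (RtoC 0))). ring.
        * intros t Ht. simpl. ring.
    - lra.
    - intros s t _ _. apply (der_ext _ (fun s : R => 0 + s * (z + t * (u - z)))%C); [intros; ring|].
      apply der_affine.
    - intros s t _ _. apply (der_ext _ (fun t : R => s * z + t * (s * (u - z)))%C); [intros; ring|].
      apply der_affine.
    - intros. apply cont_const.
    - intros. apply cont_const.
    - intros s t Hs Ht. assert (X := Seg t Hz Hu Ht). unfold inD in X. lra.
    - intros s t Hs Ht. rewrite Cmod_mult, Cmod_R, Rabs_right by lra.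
      assert (X := Cmod_ge_0 (u - z)). nra.
    - intros s t Hs Ht. apply D, Hd; auto. }
  assert (E' : RInt_C (fun t => F (z + t * (u - z)) * (u - z))%C 0 1
    = (ray_primitive F u - ray_primitive F z)%C).
  { assert (X : forall a j b : C, (a + j - b - 0 = 0)%C -> j = (b - a)%C).
    { intros a j b Y. rewrite <- (Cplus_0_r (b - a)), <- Y. ring. }
    apply X, E. }
  rewrite <- E'. apply ex_RInt_cont; [lra|]. intros t Ht.
  destruct (D (z + t * (u - z))%C) as [l Hl]; [auto|].
  apply (cont_curve F (fun t : R => z + t * (u - z))%C (fun _ => (u - z)%C) t l (u - z)%C); auto.
  - apply der_affine.
  - apply cont_const.
Qed.

Lemma ray_primitive_der F z : holoD F -> inD z -> der_at idC (ray_primitive F) z (F z).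
Proof.
  intros HF Hz. apply little_o_der; [unfold idC; intros; subst; auto|]. unfold idC.
  intros eps He.
  destruct (der_cont idC F z _ (holoD_der F z HF Hz) eps He) as (d & Hd & K). unfold idC in K.
  exists (Rmin d (1 - Cmod z)). split; [apply Rmin_pos; unfold inD in Hz; lra|]. intros u Hu.
  assert (H1 := Rlt_le_trans _ _ _ Hu (Rmin_l _ _)).
  assert (H2 := Rlt_le_trans _ _ _ Hu (Rmin_r _ _)).
  assert (Hu' : inD u).
  { unfold inD. assert (X := Cmod_sub_ge u z). lra. }
  assert (X := is_RInt_C_minus _ _ _ _ _ _ (ray_primitive_increment F z u HF Hz Hu')
                 (is_RInt_C_const 0 1 (F z * (u - z))%C)).
  replace (ray_primitive F u - ray_primitive F z - F z * (u - z))%C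
    with (ray_primitive F u - ray_primitive F z - (1 - 0)%R * (F z * (u - z)))%C
    by (rewrite RtoC_minus; ring).
  replace (eps * Cmod (u - z)) with ((1 - 0) * (eps * Cmod (u - z))) by ring.
  refine (is_RInt_C_bound _ 0 1 _ _ _ _ X); [lra|]. intros t Ht. simpl.
  replace (F (z + t * (u - z)) * (u - z) - F z * (u - z))%C
    with ((F (z + t * (u - z)) - F z) * (u - z))%C by ring.
  rewrite Cmod_mult. apply Rmult_le_compat_r; [apply Cmod_ge_0|]. apply Rlt_le, K.
  replace (z + t * (u - z) - z)%C with (t * (u - z))%C by ring.
  rewrite Cmod_mult, Cmod_R, Rabs_right by lra. assert (Y := Cmod_ge_0 (u - z)). nra.
Qed.

(** * Cauchy's formula *)

(** With period 1, integrals over [[0, 1]] are circle means. The radius may be negative: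
    [circ (d - r)] occurs as a derivative in the deformation below. *)
Definition circ (r t : R) : C := (r * cos (2 * PI * t), r * sin (2 * PI * t)).

Lemma Cmod_circ r t : 0 <= r -> Cmod (circ r t) = r.
Proof.
  intros Hr. unfold Cmod, circ; simpl.
  replace (_ + _) with (r ^ 2).
  - rewrite sqrt_pow2; auto.
  - assert (X := sin2_cos2 (2 * PI * t)). unfold Rsqr in X.
    replace (r ^ 2) with (r * r * (sin (2 * PI * t) * sin (2 * PI * t)
       + cos (2 * PI * t) * cos (2 * PI * t))) by (rewrite X; ring). ring.
Qed.

Lemma circ_scal r t : circ r t = (r * circ 1 t)%C.
Proof. unfold circ, Cmult; simpl. f_equal; ring. Qed.

Lemma is_derive_der_R h (t : R) (a b : R) :
  is_derive (fun t => fst (h t)) t a -> is_derive (fun t => snd (h t)) t b ->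
  der_R h t (a, b).
Proof.
  intros [_ Ha] [_ Hb]. specialize (Ha t (fun P HP => HP)). specialize (Hb t (fun P HP => HP)).
  apply little_o_der.
  - intros u E. injection E. intros ->. auto.
  - intros eps He.
    destruct (Ha (mkposreal (eps / 2) ltac:(lra))) as (d1 & H1).
    destruct (Hb (mkposreal (eps / 2) ltac:(lra))) as (d2 & H2).
    exists (Rmin d1 d2). split; [apply Rmin_pos; apply cond_pos|]. intros u Hu.
    rewrite <- RtoC_minus, Cmod_R in *.
    specialize (H1 u (Rlt_le_trans _ _ _ Hu (Rmin_l _ _))).
    specialize (H2 u (Rlt_le_trans _ _ _ Hu (Rmin_r _ _))).
    change (Rabs (fst (h u) - fst (h t) - (u - t) * a) <= eps / 2 * Rabs (u - t)) in H1.
    change (Rabs (snd (h u) - snd (h t) - (u - t) * b) <= eps / 2 * Rabs (u - t)) in H2.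
    replace (h u - h t - (a, b) * (u - t)%R)%C with
      (RtoC (fst (h u) - fst (h t) - (u - t) * a)%R + Ci * RtoC (snd (h u) - snd (h t) - (u - t) * b)%R)%C
      by (apply injective_projections; simpl; ring).
    eapply Rle_trans; [apply Cmod_triangle|].
    rewrite Cmod_mult, Cmod_Ci, !Cmod_R. lra.
Qed.

Lemma der_circ r t : der_R (circ r) t (2 * PI * Ci * circ r t)%C.
Proof.
  replace (2 * PI * Ci * circ r t)%C
    with (r * (2 * PI * - sin (2 * PI * t)), r * (2 * PI * cos (2 * PI * t))).
  - apply is_derive_der_R; unfold circ; simpl; auto_derive; auto; ring.
  - unfold circ. apply injective_projections; simpl; ring.
Qed.

Lemma circ_0_1 r : circ r 0 = circ r 1.
Proof.
  unfold circ. rewrite Rmult_0_r, Rmult_1_r, cos_0, sin_0, cos_2PI, sin_2PI. auto.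
Qed.

(* Deform the circle of radius [r] about 0 into a small circle about [z], inside the punctured disc. *)
Lemma cauchy_deformation f z r d : holoD f -> r < 1 -> 0 < d -> Cmod z + d < r ->
  (RInt_C (fun t => f (circ r t) / (circ r t - z) * (2 * PI * Ci * circ r t))%C 0 1
   = RInt_C (fun t => 2 * PI * Ci * f (z + circ d t))%C 0 1).
Proof.
  intros Hf Hr Hd Hz. assert (Hz0 := Cmod_ge_0 z).
  set (rho := fun s : R => r + s * (d - r)).
  set (F := fun v : C => (f v / (v - z))%C).
  (* The circle has centre [s * z] and radius [rho s]. The first inequality keeps [z] strictly
     inside it, so that [F] has no pole on it; the last keeps the circle in the unit disc. *)
  assert (Hrho : forall s, 0 <= s <= 1 -> (1 - s) * Cmod z < rho s /\ rho s <= r + s * (d - r) /\ 0 < rho s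
     /\ s * Cmod z + rho s < 1).
  { intros s Hs. unfold rho.
    assert (0 <= (1 - s) * (r - Cmod z - d)) by (apply Rmult_le_pos; lra).
    assert (0 <= (1 - s) * Cmod z) by (apply Rmult_le_pos; lra).
    repeat split; try lra; nra. }
  assert (PI_le : 0 < PI <= 4) by (split; [apply PI_RGT_0|apply PI_4]).
  assert (DF : forall v, inD v -> v <> z -> exists l, der_at idC F v l).
  { intros v Hv Hn. eexists. unfold F, Cdiv. apply (der_mult idC f (fun v => / (v - z))%C).
    - apply holoD_der; auto.
    - apply (der_inv idC (fun v => v - z)%C).
      + apply der_minus; [apply der_emb|apply der_const].
      + intros E. apply Hn. rewrite <- (Cplus_0_l z), <- E. ring. }
  (* The crude bound [10] covers both partial derivatives: [Cmod z + (r - d) < 2] and, with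
     [PI <= 4], [2 * PI * rho s <= 8]. *)
  assert (G := goursat F (fun s t => s * z + circ (rho s) t)%C (fun s t => z + circ (d - r) t)%C
    (fun s t => 2 * PI * Ci * circ (rho s) t)%C 10).
  simpl in G.
  match type of G with _ -> _ -> _ -> _ -> _ -> _ -> _ -> _ -> (?i0 + ?j1 - ?i1 - ?j0)%C = _ =>
    assert (E : (i0 + j1 - i1 - j0 = 0)%C); [apply G; clear G|] end.
  - lra.
  - intros s t _ _.
    apply (der_ext _ (fun s : R => circ r t + s * (z + circ (d - r) t))%C); [|apply der_affine].
    intros u. rewrite (circ_scal r), (circ_scal (d - r)), (circ_scal (rho u)). unfold rho.
    rewrite RtoC_plus, RtoC_mult, RtoC_minus. ring.
  - intros s t _ _. replace (2 * PI * Ci * circ (rho s) t)%C with (0 + 2 * PI * Ci * circ (rho s) t)%C by ring.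
    apply der_plus; [apply der_const|apply der_circ].
  - intros. apply cont_const.
  - intros. apply cont_mult; [apply cont_const|]. eapply der_cont, der_circ.
  - intros s t Hs Ht. eapply Rle_trans; [apply Cmod_triangle|].
    replace (circ (d - r) t) with (- circ (r - d) t)%C
      by (unfold circ; apply injective_projections; simpl; ring).
    rewrite Cmod_opp, Cmod_circ by lra. lra.
  - intros s t Hs Ht. destruct (Hrho s Hs) as (A1 & A2 & A3 & A4).
    rewrite !Cmod_mult, Cmod_Ci, !Cmod_R, Cmod_circ, !Rabs_right by lra.
    assert (0 <= s * Cmod z) by (apply Rmult_le_pos; lra).
    assert (PI * rho s <= 4 * 1) by (apply Rmult_le_compat; lra). nra.
  - intros s t Hs Ht. destruct (Hrho s Hs) as (A1 & A2 & A3 & A4). apply DF.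
    + unfold inD. eapply Rle_lt_trans; [apply Cmod_triangle|].
      rewrite Cmod_mult, Cmod_R, Cmod_circ, Rabs_right by lra. auto.
    + intros E. assert (E' : circ (rho s) t = (RtoC (1 - s) * z)%C).
      { rewrite RtoC_minus. replace ((1 - s) * z)%C with (z - s * z)%C by ring. rewrite <- E at 1. ring. }
      apply (f_equal Cmod) in E'. rewrite Cmod_mult, Cmod_circ, Cmod_R, Rabs_right in E' by lra. lra.
  (* The edges [t = 0] and [t = 1] are the same curve by periodicity and cancel, which leaves the
     equality of the integrals over the two circles. *)
  - match type of E with (?i0 + ?j1 - ?i1 - ?j0)%C = _ => assert (I : i0 = i1) end.
    { apply RInt_C_ext; [lra|]. intros s Hs. rewrite <- !circ_0_1. reflexivity. }
    rewrite I in E.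
    match type of E with (?i0 + ?j1 - ?i1 - ?j0)%C = _ => assert (E' : j0 = j1) end.
    { assert (X : forall a b j : C, (a + b - a - j = 0)%C -> j = b).
      { intros a b j Y. rewrite <- (Cplus_0_r j), <- Y. ring. }
      eapply X, E. }
    transitivity (RInt_C (fun t => F (0%R * z + circ (rho 0) t) * (2 * PI * Ci * circ (rho 0) t))%C 0 1).
    + apply RInt_C_ext; [lra|]. intros t Ht. unfold F, rho. rewrite Rmult_0_l, Rplus_0_r.
      replace (0%R * z + circ r t)%C with (circ r t) by ring. reflexivity.
    + rewrite E'. apply RInt_C_ext; [lra|]. intros t Ht. unfold F, rho.
      replace (r + 1 * (d - r)) with d by ring. rewrite Cmult_1_l.
      eqC. field.
      replace (z + circ d t - z)%C with (circ d t) by ring. apply Cmod_neq0. rewrite Cmod_circ; lra.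
Qed.

Definition circle_mean (r : R) (h : C -> C) : C := RInt_C (fun t => h (circ r t)) 0 1.

Lemma circle_mean_correct r h : 0 <= r -> (forall v, Cmod v = r -> cont_at idC h v) ->
  is_RInt_C (fun t => h (circ r t)) 0 1 (circle_mean r h).
Proof.
  intros Hr H. apply ex_RInt_cont; [lra|]. intros t _. apply cont_comp.
  - apply H, Cmod_circ, Hr.
  - eapply der_cont, der_circ.
Qed.

Lemma circle_mean_bound r h M : 0 <= r -> (forall v, Cmod v = r -> cont_at idC h v) ->
  (forall t, 0 <= t <= 1 -> Cmod (h (circ r t)) <= M) -> Cmod (circle_mean r h) <= M.
Proof.
  intros Hr H HM. replace M with ((1 - 0) * M) by ring.
  eapply is_RInt_C_bound; [lra|exact HM|]. apply circle_mean_correct; auto.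
Qed.

Lemma cont_minus_const z v : cont_at idC (fun u => u - z)%C v.
Proof. eapply der_cont, der_minus; [apply der_emb|apply der_const]. Qed.

Lemma cont_pow h v n : cont_at idC h v -> cont_at idC (fun u => h u ^ n)%C v.
Proof.
  intros H. induction n as [|n IH].
  - apply cont_ext with (fun _ => RtoC 1); [reflexivity|apply cont_const].
  - apply cont_ext with (fun u => h u * h u ^ n)%C; [intros; rewrite Cpow_S; auto|].
    apply cont_mult; auto.
Qed.

Lemma cont_emb_idC v : cont_at idC (fun u => u) v.
Proof. apply cont_emb. Qed.

Lemma Cminus_neq0_of_Cmod v z : Cmod z < Cmod v -> (v - z)%C <> 0%C.
Proof. intros H. apply Cmod_neq0. assert (X := Cmod_sub_ge v z). lra. Qed.

Ltac cont_kernel :=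
  repeat first [ assumption | apply cont_const | apply cont_emb_idC | apply cont_minus_const
               | apply cont_mult | apply cont_plus | apply cont_pow | apply (cont_inv idC) ].

Lemma cont_holoD f v : holoD f -> inD v -> cont_at idC f v.
Proof. intros Hf Hv. eapply der_cont, holoD_der; auto. Qed.

(** On the circle [dv = 2 pi i v dt], so the contour integral becomes a mean with the extra factor
    [v], and [2 pi i] cancels. The mean of [f] over an arbitrarily small circle about [z] is close
    to [f z] by continuity. *)
Lemma cauchy_formula f r z : holoD f -> r < 1 -> Cmod z < r ->
  circle_mean r (fun v => f v * v * / (v - z))%C = f z.
Proof.
  intros Hf Hr Hz. assert (Hz0 := Cmod_ge_0 z).
  set (k := fun v : C => (f v * v * / (v - z))%C).
  assert (Hk : forall v, Cmod v = r -> cont_at idC k v).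
  { intros v Hv. unfold k. assert (cont_at idC f v) by (apply cont_holoD; unfold inD; auto; lra).
    cont_kernel. apply Cminus_neq0_of_Cmod. lra. }
  set (c := (2 * PI * Ci)%C).
  assert (Hpi : c <> 0%C).
  { apply Cmod_neq0. unfold c. rewrite !Cmod_mult, Cmod_Ci, !Cmod_R. assert (X := PI_RGT_0).
    rewrite !Rabs_right by lra. lra. }
  assert (Hi := circle_mean_correct r k ltac:(lra) Hk).
  assert (E : forall eps, 0 < eps -> Cmod (circle_mean r k - f z) <= eps).
  { intros eps He.
    destruct (cont_holoD f z Hf ltac:(unfold inD; lra) eps He) as (d & Hd & K). unfold idC in K.
    set (d' := Rmin (d / 2) ((r - Cmod z) / 2)).
    assert (Hd' : 0 < d') by (unfold d'; apply Rmin_pos; lra).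
    assert (d' <= d / 2) by apply Rmin_l.
    assert (d' <= (r - Cmod z) / 2) by apply Rmin_r.
    assert (Hc : forall t, cont_R (fun t => f (z + circ d' t))%C t).
    { intros t. apply (cont_comp RtoC f (fun t => z + circ d' t)%C).
      - apply cont_holoD; auto. unfold inD. eapply Rle_lt_trans; [apply Cmod_triangle|].
        rewrite Cmod_circ; lra.
      - apply cont_plus; [apply cont_const|]. eapply der_cont, der_circ. }
    assert (H1 := ex_RInt_cont _ 0 1 Rle_0_1 (fun t _ => Hc t)).
    assert (X := cauchy_deformation f z r d' Hf Hr Hd' ltac:(lra)). fold c in X.
    assert (A1 := RInt_C_unique _ _ _ _ (is_RInt_C_scal c _ _ _ _ H1)).
    assert (A2 := RInt_C_unique _ _ _ _ (is_RInt_C_scal c _ _ _ _ Hi)).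
    assert (Y : (c * circle_mean r k = c * RInt_C (fun t => f (z + circ d' t))%C 0 1)%C).
    { rewrite <- A1, <- A2. etransitivity; [|exact X]. apply RInt_C_ext; [lra|].
      intros t Ht. unfold k, Cdiv. eqC. ring. }
    apply (f_equal (fun a => / c * a)%C) in Y.
    rewrite !Cmult_assoc, !Cinv_l, !Cmult_1_l in Y by auto.
    rewrite Y.
    replace (RInt_C (fun t => f (z + circ d' t))%C 0 1 - f z)%C
      with (RInt_C (fun t => f (z + circ d' t))%C 0 1 - (1 - 0)%R * f z)%C by (rewrite RtoC_minus; ring).
    replace eps with ((1 - 0) * eps) by ring.
    refine (is_RInt_C_bound _ 0 1 _ _ _ _ (is_RInt_C_minus _ _ _ _ _ _ H1 (is_RInt_C_const 0 1 (f z))));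
      [lra|].
    intros t Ht. apply Rlt_le, K.
    replace (z + circ d' t - z)%C with (circ d' t) by ring. rewrite Cmod_circ; lra. }
  assert (Z : Cmod (circle_mean r k - f z) = 0).
  { apply Rle_antisym; [|apply Cmod_ge_0]. apply Rnot_lt_le. intros L.
    specialize (E (Cmod (circle_mean r k - f z) / 2)). lra. }
  apply Cmod_eq_0 in Z. rewrite <- (Cplus_0_r (f z)), <- Z. ring.
Qed.

(** * Cauchy estimates and Taylor remainders *)

Lemma circle_bounded f r : holoD f -> 0 <= r < 1 ->
  exists M, 0 < M /\ forall t, 0 <= t <= 1 -> Cmod (f (circ r t)) <= M.
Proof.
  intros Hf Hr.
  destruct (continuity_ab_maj (fun t => Cmod (f (circ r t))) 0 1) as (tM & HM & _); [lra| |].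
  - intros t _. apply continuity_pt_filterlim. intros P [eps HP].
    assert (Hc : cont_R (fun t => f (circ r t)) t).
    { apply cont_comp; [apply cont_holoD; auto; unfold inD; rewrite Cmod_circ; lra|].
      eapply der_cont, der_circ. }
    destruct (Hc eps (cond_pos eps)) as (d & Hd & K).
    exists (mkposreal d Hd). intros u Hu. apply HP.
    assert (Ku : Cmod (f (circ r u) - f (circ r t)) < eps).
    { apply K. rewrite <- RtoC_minus, Cmod_R. exact Hu. }
    apply Rabs_def1.
    + assert (X := Cmod_sub_ge (f (circ r u)) (f (circ r t))).
      unfold minus, plus, opp; simpl. lra.
    + assert (X := Cmod_sub_ge (f (circ r t)) (f (circ r u))).
      rewrite Cmod_minus_sym in X. unfold minus, plus, opp; simpl. lra.
  - exists (Cmod (f (circ r tM)) + 1). split; [assert (X := Cmod_ge_0 (f (circ r tM))); lra|].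
    intros t Ht. specialize (HM t Ht). simpl in HM. lra.
Qed.

Lemma Cmod_inv_sub v z r s : Cmod v = r -> Cmod z <= s -> s < r -> Cmod (/ (v - z)) <= / (r - s).
Proof.
  intros Hv Hz Hs. rewrite Cmod_inv by (apply Cminus_neq0_of_Cmod; lra).
  apply Rinv_le_contravar; [lra|]. assert (X := Cmod_sub_ge v z). lra.
Qed.

(** Cauchy's formula produces remainders of this form. Their constant depends only on a bound over a
    circle, so they also pass to pointwise limits. *)
Lemma little_o_of_quadratic F z l B rho : 0 <= B -> 0 < rho ->
  (forall u, Cmod (u - z) < rho -> Cmod (F u - F z - (u - z) * l) <= B * Cmod (u - z) ^ 2) ->
  der_at idC F z l.
Proof.
  intros HB Hrho H. apply little_o_der; [unfold idC; intros; subst; auto|]. unfold idC.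
  intros eps He. exists (Rmin rho (eps / (B + 1))). split.
  { apply Rmin_pos; [lra|]. apply Rdiv_lt_0_compat; lra. }
  intros u Hu.
  assert (H1 := Rlt_le_trans _ _ _ Hu (Rmin_l _ _)).
  assert (H2 := Rlt_le_trans _ _ _ Hu (Rmin_r _ _)).
  rewrite Cmult_comm. eapply Rle_trans; [apply H; auto|].
  assert (P := Cmod_ge_0 (u - z)).
  assert (Q : (B + 1) * Cmod (u - z) <= eps).
  { replace eps with ((B + 1) * (eps / (B + 1))) by (field; lra). apply Rmult_le_compat_l; lra. }
  nra.
Qed.

Section CauchyEstimates.

Variables (f : C -> C) (r s M : R).
Hypothesis Hf : holoD f.
Hypothesis Hs : 0 <= s < r.
Hypothesis Hr : r < 1.
Hypothesis HM : forall t, 0 <= t <= 1 -> Cmod (f (circ r t)) <= M.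

(** Values and derivatives of [f] are all means of this form, linear in the kernel, so algebraic
    identities between kernels become statements about [f]. *)
Let kernel_mean (k : C -> C) : C := circle_mean r (fun v => f v * v * k v)%C.

Lemma bound_nonneg : 0 <= M.
Proof. eapply Rle_trans; [apply Cmod_ge_0|apply (HM 0); lra]. Qed.

Lemma kernel_cont k v : Cmod v = r -> cont_at idC k v -> cont_at idC (fun v => f v * v * k v)%C v.
Proof.
  intros Hv Hk. assert (cont_at idC f v) by (apply cont_holoD; unfold inD; auto; lra).
  cont_kernel.
Qed.

Lemma kernel_mean_bound k B : 0 <= B -> (forall v, Cmod v = r -> cont_at idC k v) ->
  (forall v, Cmod v = r -> Cmod (k v) <= B) -> Cmod (kernel_mean k) <= M * r * B.
Proof.
  intros HB Hk Hb. unfold kernel_mean. apply (circle_mean_bound r (fun v => f v * v * k v)%C); [lra| |].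
  - intros v Hv. apply kernel_cont; auto.
  - intros t Ht. assert (E : Cmod (circ r t) = r) by (apply Cmod_circ; lra).
    rewrite !Cmod_mult, E. apply Rmult_le_compat; auto using Cmod_ge_0.
    + apply Rmult_le_pos; [apply Cmod_ge_0|lra].
    + apply Rmult_le_compat_r; [lra|auto].
Qed.

(** The shape fits its three uses: the first-order remainders of [f] and of its derivative, and one
    step of the geometric expansion of the Cauchy kernel. *)
Lemma kernel_mean_combine (c : C) k1 k2 k3 k4 :
  (forall v, Cmod v = r -> cont_at idC k1 v) -> (forall v, Cmod v = r -> cont_at idC k2 v) ->
  (forall v, Cmod v = r -> cont_at idC k3 v) ->
  (forall v, Cmod v = r -> (k1 v - k2 v - c * k3 v = k4 v)%C) ->
  (kernel_mean k1 - kernel_mean k2 - c * kernel_mean k3 = kernel_mean k4)%C.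
Proof.
  intros H1 H2 H3 E. symmetry. apply RInt_C_unique.
  assert (X : forall k, (forall v, Cmod v = r -> cont_at idC k v) ->
    is_RInt_C (fun t => f (circ r t) * circ r t * k (circ r t))%C 0 1 (kernel_mean k)).
  { intros k Hk. apply (circle_mean_correct r (fun v => f v * v * k v)%C); [lra|].
    intros v Hv. apply kernel_cont; auto. }
  refine (is_RInt_C_ext _ _ _ _ _ Rle_0_1 _ (is_RInt_C_minus _ _ _ _ _ _
    (is_RInt_C_minus _ _ _ _ _ _ (X k1 H1) (X k2 H2)) (is_RInt_C_scal c _ _ _ _ (X k3 H3)))).
  intros t _. rewrite <- (E (circ r t)) by (apply Cmod_circ; lra). eqC. ring.
Qed.

Let K (n : nat) (z : C) : C -> C := fun v => ((/ (v - z)) ^ n)%C.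

Lemma K_cont n z v : Cmod z <= s -> Cmod v = r -> cont_at idC (K n z) v.
Proof. intros Hz Hv. unfold K. cont_kernel. apply Cminus_neq0_of_Cmod. lra. Qed.

Lemma K_bound n z v : Cmod z <= s -> Cmod v = r -> Cmod (K n z v) <= / (r - s) ^ n.
Proof.
  intros Hz Hv. unfold K. rewrite Cmod_pow, <- pow_inv. apply pow_incr.
  split; [apply Cmod_ge_0|]. apply Cmod_inv_sub; auto; lra.
Qed.

Lemma cauchy_formula_K z : Cmod z <= s -> kernel_mean (K 1 z) = f z.
Proof.
  intros Hz. rewrite <- (cauchy_formula f r z Hf Hr) by lra.
  apply RInt_C_ext; [lra|]. intros t _. unfold K. rewrite Cpow_1_r. reflexivity.
Qed.

Lemma cauchy_value_bound z : Cmod z <= s -> Cmod (f z) <= M * r * / (r - s).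
Proof.
  intros Hz. rewrite <- cauchy_formula_K by auto.
  assert (P : 0 < / (r - s)) by (apply Rinv_0_lt_compat; lra).
  apply kernel_mean_bound; [lra|intros; apply K_cont; auto|].
  intros v Hv. rewrite <- (pow_1 (r - s)). apply K_bound; auto.
Qed.

Lemma inv_pow_nonneg n : 0 <= / (r - s) ^ n.
Proof. apply Rlt_le, Rinv_0_lt_compat, pow_lt. lra. Qed.

(** With [a = v - z] the kernels satisfy [1/(a - h) - 1/a - h/a^2 = h^2 / (a^2 (a - h))], and each
    of the three factors of the denominator is at least [r - s] in modulus. *)
Lemma cauchy_second_order_kernel z h : Cmod z <= s -> Cmod (z + h) <= s ->
  Cmod (f (z + h) - f z - h * kernel_mean (K 2 z))%C <= M * r * / (r - s) ^ 3 * Cmod h ^ 2.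
Proof.
  intros Hz Hzh.
  rewrite <- (cauchy_formula_K z), <- (cauchy_formula_K (z + h)) by auto.
  rewrite (kernel_mean_combine h _ _ _ (fun v => h ^ 2 * (K 2 z v * K 1 (z + h) v))%C);
    try (intros; apply K_cont; auto).
  - rewrite Rmult_assoc. apply kernel_mean_bound.
    + apply Rmult_le_pos; [apply inv_pow_nonneg|apply pow_le, Cmod_ge_0].
    + intros v Hv. apply cont_mult; [apply cont_const|]. apply cont_mult; apply K_cont; auto.
    + intros v Hv. rewrite !Cmod_mult, Cmod_pow, Rmult_comm.
      apply Rmult_le_compat_r; [apply pow_le, Cmod_ge_0|].
      replace (/ (r - s) ^ 3) with (/ (r - s) ^ 2 * / (r - s) ^ 1) by (field; lra).
      apply Rmult_le_compat; auto using Cmod_ge_0, K_bound.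
  - intros v Hv. unfold K. simpl. field. split; apply Cminus_neq0_of_Cmod; lra.
Qed.

Lemma Cmod_le_of_near z u : Cmod (u - z) < s - Cmod z -> Cmod u <= s.
Proof. intros H. assert (Y := Cmod_sub_ge u z). lra. Qed.

Lemma der_kernel z : Cmod z < s -> der_at idC f z (kernel_mean (K 2 z)).
Proof.
  intros Hz. apply little_o_of_quadratic with (M * r * / (r - s) ^ 3) (s - Cmod z).
  - assert (X := bound_nonneg). apply Rmult_le_pos; [apply Rmult_le_pos; lra|apply inv_pow_nonneg].
  - lra.
  - intros u Hu. assert (X := cauchy_second_order_kernel z (u - z)).
    replace (z + (u - z))%C with u in X by ring. apply X; [lra|]. eapply Cmod_le_of_near, Hu.
Qed.

Lemma dC_kernel z : Cmod z < s -> dC f z = kernel_mean (K 2 z).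
Proof. intros Hz. apply dC_eq, der_kernel, Hz. Qed.

Lemma cauchy_second_order z h : Cmod z < s -> Cmod (z + h) <= s ->
  Cmod (f (z + h) - f z - h * dC f z)%C <= M * r * / (r - s) ^ 3 * Cmod h ^ 2.
Proof. intros Hz Hzh. rewrite dC_kernel by auto. apply cauchy_second_order_kernel; auto; lra. Qed.

Lemma cauchy_derivative_bound z : Cmod z < s -> Cmod (dC f z) <= M * r * / (r - s) ^ 2.
Proof.
  intros Hz. rewrite dC_kernel by auto. apply kernel_mean_bound.
  - apply inv_pow_nonneg.
  - intros; apply K_cont; auto; lra.
  - intros; apply K_bound; auto; lra.
Qed.

(** This is the second derivative. With [a = v - z] and [h = u - z] the remainder is [1/(a - h)^2 -
    1/a^2 - 2h/a^3 = h^2 (3a - 2h) / (a^3 (a - h)^2)]; the constant 6 bounds [3a - 2h = 3v - z - 2u]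
    in the unit disc. *)
Lemma der_kernel_2 z : Cmod z < s ->
  der_at idC (fun z => kernel_mean (K 2 z)) z (kernel_mean (fun v => 2 * K 3 z v)%C).
Proof.
  intros Hz. apply little_o_of_quadratic with (M * r * (6 * / (r - s) ^ 5)) (s - Cmod z).
  - assert (X := bound_nonneg). assert (Y := inv_pow_nonneg 5).
    apply Rmult_le_pos; [apply Rmult_le_pos; lra|lra].
  - lra.
  - intros u Hu. apply Cmod_le_of_near in Hu. assert (Hz' : Cmod z <= s) by lra.
    rewrite (kernel_mean_combine (u - z) _ _ _
      (fun v => (u - z) ^ 2 * ((3 * (v - z) + - (2) * (u - z)) * (K 3 z v * K 2 u v)))%C).
    2, 3: intros; apply K_cont; auto.
    2: intros; apply cont_mult; [apply cont_const|apply K_cont; auto].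
    + rewrite Rmult_assoc. apply kernel_mean_bound.
      * assert (Y := inv_pow_nonneg 5). apply Rmult_le_pos; [lra|apply pow_le, Cmod_ge_0].
      * intros v Hv. apply cont_mult; [apply cont_const|].
        apply cont_mult; [cont_kernel|apply cont_mult; apply K_cont; auto].
      * intros v Hv. rewrite !Cmod_mult, Cmod_pow, Rmult_comm.
        apply Rmult_le_compat_r; [apply pow_le, Cmod_ge_0|].
        replace (/ (r - s) ^ 5) with (/ (r - s) ^ 3 * / (r - s) ^ 2) by (field; lra).
        apply Rmult_le_compat; [apply Cmod_ge_0| | |].
        { apply Rmult_le_pos; apply Cmod_ge_0. }
        { replace (3 * (v - z) + - (2) * (u - z))%C with (3 * v - (z + 2 * u))%C by ring.
          eapply Rle_trans; [apply Cmod_sub_le|].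
          assert (T := Cmod_triangle z (2 * u)).
          rewrite (Cmod_mult 3), (Cmod_mult 2), !Cmod_R, !Rabs_right in * by lra. lra. }
        { apply Rmult_le_compat; auto using Cmod_ge_0, K_bound. }
    + intros v Hv. unfold K. simpl. field. split; apply Cminus_neq0_of_Cmod; lra.
Qed.

(** Iterating [1/(v - z) = 1/v + (z/v)/(v - z)] splits off one Taylor term at a time, and the
    remaining kernel decays like [(s / r) ^ n]. Thus finitely many coefficients control the function
    on the smaller disc. *)
Lemma cauchy_taylor_remainder z n eta : Cmod z <= s ->
  (forall k, (k < n)%nat -> Cmod (circle_mean r (fun v => f v * (/ v) ^ k)%C) <= eta) ->
  Cmod (f z) <= INR n * eta + M * r * ((s / r) ^ n * / (r - s)).
Proof.
  intros Hz Heta.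
  set (rem := fun k v => ((z * / v) ^ k * / (v - z))%C).
  assert (Hinv : forall v, Cmod v = r -> v <> 0%C) by (intros v Hv; apply Cmod_neq0; lra).
  assert (Hrem : forall k v, Cmod v = r -> cont_at idC (rem k) v).
  { intros k v Hv. unfold rem. cont_kernel; auto. apply Cminus_neq0_of_Cmod; lra. }
  assert (Hco : forall k v, Cmod v = r -> cont_at idC (fun v => (/ v) ^ S k)%C v).
  { intros k v Hv. cont_kernel; auto. }
  (* The factor [v] built into [kernel_mean] absorbs one power, so exponent [S k] in the kernel
     gives the coefficient of index [k]. *)
  assert (Eco : forall k, kernel_mean (fun v => (/ v) ^ S k)%C = circle_mean r (fun v => f v * (/ v) ^ k)%C).
  { intros k. apply RInt_C_ext; [lra|]. intros t _.
    assert (N := Hinv (circ r t) ltac:(apply Cmod_circ; lra)).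
    rewrite Cpow_S. eqC. field. auto. }
  assert (Step : forall k, (kernel_mean (rem k) = z ^ k * kernel_mean (fun v => (/ v) ^ S k) + kernel_mean (rem (S k)))%C).
  { intros k.
    assert (X := kernel_mean_combine (z ^ k) (rem k) (rem (S k)) (fun v => (/ v) ^ S k)%C (fun _ => RtoC 0)
       (Hrem k) (Hrem (S k)) (Hco k)).
    assert (Y : kernel_mean (fun _ => RtoC 0) = RtoC 0).
    { apply Cmod_eq_0. apply Rle_antisym; [|apply Cmod_ge_0].
      apply Rle_trans with (M * r * 0); [|lra].
      apply kernel_mean_bound; [lra|intros; apply cont_const|].
      intros; rewrite Cmod_0; lra. }
    assert (Solve : forall a b c : C, (a - b - c = 0)%C -> (a = c + b)%C).
    { intros a b c E. rewrite <- (Cplus_0_r (c + b)), <- E. ring. }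
    rewrite Y in X. apply Solve, X.
    intros v Hv. unfold rem. assert (N := Hinv v Hv). rewrite !Cpow_S, !Cpow_mult_l.
    field. split; auto. apply Cminus_neq0_of_Cmod; lra. }
  assert (Hz1 : forall k, Cmod z ^ k <= 1).
  { intros k. rewrite <- (pow1 k). apply pow_incr. split; [apply Cmod_ge_0|lra]. }
  assert (IH : forall k, (k <= n)%nat -> Cmod (f z) <= INR k * eta + Cmod (kernel_mean (rem k))).
  { induction k as [|k IH]; intros Hk.
    - rewrite <- (cauchy_formula_K z Hz). simpl. right. rewrite Rmult_0_l, Rplus_0_l. f_equal.
      apply RInt_C_ext; [lra|]. intros t _. unfold rem, K. simpl. eqC. ring.
    - eapply Rle_trans; [apply IH; lia|]. rewrite Step, Eco, S_INR.
      assert (T := Cmod_triangle (z ^ k * circle_mean r (fun v => f v * (/ v) ^ k)%C) (kernel_mean (rem (S k)))).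
      rewrite Cmod_mult, Cmod_pow in T.
      assert (A := Heta k ltac:(lia)). assert (B := Hz1 k).
      assert (P := Cmod_ge_0 (circle_mean r (fun v => f v * (/ v) ^ k)%C)).
      assert (Q : 0 <= Cmod z ^ k) by (apply pow_le, Cmod_ge_0).
      nra. }
  eapply Rle_trans; [apply (IH n); lia|]. apply Rplus_le_compat_l.
  assert (P : 0 < / (r - s)) by (apply Rinv_0_lt_compat; lra).
  assert (Q : 0 <= s / r) by (apply Rdiv_le_0_compat; lra).
  apply kernel_mean_bound; auto.
  - apply Rmult_le_pos; [apply pow_le; auto|lra].
  - intros v Hv. unfold rem. rewrite Cmod_mult, Cmod_pow, Cmod_mult, Cmod_inv by auto.
    apply Rmult_le_compat; [apply pow_le|apply Cmod_ge_0| |apply Cmod_inv_sub; auto; lra].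
    + apply Rmult_le_pos; [apply Cmod_ge_0|]. rewrite Hv. apply Rlt_le, Rinv_0_lt_compat; lra.
    + apply pow_incr. rewrite Hv. assert (X : 0 < / r) by (apply Rinv_0_lt_compat; lra).
      split; [apply Rmult_le_pos; [apply Cmod_ge_0|lra]|]. apply Rmult_le_compat_r; lra.
Qed.

End CauchyEstimates.

(** * Extraction of subsequences *)

Definition extraction (phi : nat -> nat) : Prop := forall n, (phi n < phi (S n))%nat.

Lemma extraction_lt phi n m : extraction phi -> (n < m)%nat -> (phi n < phi m)%nat.
Proof.
  intros H L. induction L as [|m L IH]; [apply H|]. specialize (H m). lia.
Qed.

Lemma extraction_ge phi n : extraction phi -> (n <= phi n)%nat.
Proof. intros H. induction n as [|n IH]; [lia|]. specialize (H n). lia. Qed.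

Lemma extraction_comp phi psi : extraction phi -> extraction psi -> extraction (fun n => phi (psi n)).
Proof. intros H K n. apply extraction_lt; auto. Qed.

Lemma bounded_extraction (x : nat -> R) B : (forall n, Rabs (x n) <= B) ->
  exists phi l, extraction phi /\ Un_cv (fun n => x (phi n)) l.
Proof.
  intros HB.
  destruct (Bolzano_Weierstrass x (fun c => - B <= c <= B)) as [l Hl].
  - apply compact_P3.
  - intros n. apply Rabs_le_between, HB.
  - assert (H : forall p : nat * nat, exists q, (snd p <= q)%nat /\ Rabs (x q - l) < / INR (S (fst p))).
    { intros [n N]. simpl fst; simpl snd.
      assert (P : 0 < / INR (S n)) by (apply Rinv_0_lt_compat, lt_0_INR; lia).
      destruct (Hl (disc l (mkposreal _ P)) N) as (q & Hq & Hd).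
      - exists (mkposreal _ P). intros y Hy; exact Hy.
      - exists q. split; auto. }
    apply functional_choice in H. destruct H as [f Hf].
    (* [f (n, N)] is an index at least [N] whose term lies within [/ INR (S n)] of [l]; starting
       again from [S (phi m)] forces strict growth. *)
    set (phi := fix phi n := match n with O => f (O, O) | S m => f (S m, S (phi m)) end).
    assert (Hphi : forall n, Rabs (x (phi n) - l) < / INR (S n)).
    { intros [|n]; [apply (Hf (O, O))|apply (Hf (S n, S (phi n)))]. }
    exists phi, l. split.
    + intros n. apply (Hf (S n, S (phi n))).
    + intros eps He. destruct (archimed_cor1 eps He) as (N & HN & HN0).
      exists N. intros n Hn. unfold Rdist.
      apply Rlt_trans with (1 := Hphi n). apply Rle_lt_trans with (2 := HN).
      apply Rinv_le_contravar; [apply lt_0_INR; lia|apply le_INR; lia].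
Qed.

(** [Psi (S j)] refines [Psi j]. From index [k] on, the diagonal therefore runs through terms of
    [Psi k] whose positions are at least as large, and it inherits the limit along [Psi k]. *)
Lemma diagonal_extraction (x : nat -> nat -> R) :
  (forall k, exists B, forall n, Rabs (x k n) <= B) ->
  exists phi, extraction phi /\ forall k, exists l, Un_cv (fun n => x k (phi n)) l.
Proof.
  intros HB.
  assert (H : forall p : nat * (nat -> nat), exists theta, extraction theta /\
     exists l, Un_cv (fun n => x (fst p) (snd p (theta n))) l).
  { intros [k psi]. simpl fst; simpl snd. destruct (HB k) as [B HBk].
    destruct (bounded_extraction (fun n => x k (psi n)) B) as (theta & l & A1 & A2); eauto. }
  apply functional_choice in H. destruct H as [sel Hsel].
  set (Psi := fix Psi k := match k with
    | O => sel (O, fun n => n) | S j => fun n => Psi j (sel (S j, Psi j) n) end).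
  assert (HPsi : forall k, extraction (Psi k)).
  { induction k as [|k IH]; [apply (Hsel (O, fun n => n))|].
    apply (extraction_comp (Psi k)); auto. apply (Hsel (S k, Psi k)). }
  assert (Hcv : forall k, exists l, Un_cv (fun n => x k (Psi k n)) l).
  { intros [|k]; [apply (Hsel (O, fun n => n))|apply (Hsel (S k, Psi k))]. }
  assert (Hnest : forall k i n, exists m, (n <= m)%nat /\ Psi (k + i)%nat n = Psi k m).
  { intros k i. induction i as [|i IH]; intros n.
    - exists n. rewrite Nat.add_0_r. auto.
    - rewrite Nat.add_succ_r. simpl.
      destruct (IH (sel (S (k + i), Psi (k + i)%nat) n)) as (m & Hm & E).
      exists m. split; auto. apply Nat.le_trans with (2 := Hm).
      apply extraction_ge, (Hsel (S (k + i), Psi (k + i)%nat)). }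
  exists (fun n => Psi n n). split.
  (* The next diagonal term is [Psi n] at the position selected for [S n], and an extraction never
     selects less than its argument, here more than [n]. *)
  - intros n. simpl. apply extraction_lt; auto.
    assert (X := extraction_ge _ (S n) (proj1 (Hsel (S n, Psi n)))). lia.
  - intros k. destruct (Hcv k) as [l Hl]. exists l. intros eps He.
    destruct (Hl eps He) as [N HN]. exists (max k N). intros n Hn.
    destruct (Hnest k (n - k)%nat n) as (m & Hm & E).
    replace (k + (n - k))%nat with n in E by lia. rewrite E. apply HN. lia.
Qed.

Definition C_cauchy (u : nat -> C) : Prop := forall eps, 0 < eps ->
  exists N, forall n m, (N <= n)%nat -> (N <= m)%nat -> Cmod (u n - u m) <= eps.

Definition C_cv (u : nat -> C) (l : C) : Prop := forall eps, 0 < eps ->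
  exists N, forall n, (N <= n)%nat -> Cmod (u n - l) <= eps.

Lemma Cmod_le_components (z : C) : Cmod z <= Rabs (fst z) + Rabs (snd z).
Proof.
  replace z with (RtoC (fst z) + Ci * RtoC (snd z))%C at 1
    by (apply injective_projections; simpl; ring).
  eapply Rle_trans; [apply Cmod_triangle|]. rewrite Cmod_mult, Cmod_Ci, !Cmod_R. lra.
Qed.

Lemma C_cv_of_components u a b :
  Un_cv (fun n => fst (u n)) a -> Un_cv (fun n => snd (u n)) b -> C_cv u (a, b).
Proof.
  intros H K eps He. destruct (H (eps / 2)) as [N1 H1]; [lra|]. destruct (K (eps / 2)) as [N2 H2]; [lra|].
  exists (max N1 N2). intros n Hn. eapply Rle_trans; [apply Cmod_le_components|]. simpl.
  specialize (H1 n ltac:(lia)). specialize (H2 n ltac:(lia)). unfold Rdist in *.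
  unfold Rminus in *. lra.
Qed.

Lemma Cmod_components (z : C) : Rabs (fst z) <= Cmod z /\ Rabs (snd z) <= Cmod z.
Proof.
  assert (X := Rmax_Cmod z). assert (A := Rmax_l (Rabs (fst z)) (Rabs (snd z))).
  assert (B := Rmax_r (Rabs (fst z)) (Rabs (snd z))). lra.
Qed.

Lemma C_complete u : C_cauchy u -> exists l, C_cv u l.
Proof.
  intros H.
  destruct (Rcomplete.R_complete (fun n => fst (u n))) as [a Ha].
  { intros eps He. destruct (H (eps / 2)) as [N HN]; [lra|]. exists N. intros n m Hn Hm.
    specialize (HN n m Hn Hm). assert (X := Cmod_components (u n - u m)). simpl in X.
    unfold Rdist, Rminus in *. lra. }
  destruct (Rcomplete.R_complete (fun n => snd (u n))) as [b Hb].
  { intros eps He. destruct (H (eps / 2)) as [N HN]; [lra|]. exists N. intros n m Hn Hm.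
    specialize (HN n m Hn Hm). assert (X := Cmod_components (u n - u m)). simpl in X.
    unfold Rdist, Rminus in *. lra. }
  exists (a, b). apply C_cv_of_components; auto.
Qed.

Lemma C_cv_cauchy u l : C_cv u l -> C_cauchy u.
Proof.
  intros H eps He. destruct (H (eps / 2)) as [N HN]; [lra|]. exists N. intros n m Hn Hm.
  replace (u n - u m)%C with ((u n - l) - (u m - l))%C by ring.
  assert (X := Cmod_sub_le (u n - l) (u m - l)). specialize (HN n Hn) as A. specialize (HN m Hm) as B. lra.
Qed.

Lemma C_cv_bound u l c B : C_cv u l -> (forall n, Cmod (u n - c) <= B) -> Cmod (l - c) <= B.
Proof.
  intros H HB. apply Rnot_lt_le. intros L.
  destruct (H ((Cmod (l - c) - B) / 2)) as [N HN]; [lra|].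
  specialize (HN N (le_n N)). specialize (HB N).
  assert (X := Cmod_sub_le (u N - c) (u N - l)).
  replace (u N - c - (u N - l))%C with (l - c)%C in X by ring. lra.
Qed.

Lemma C_diagonal_extraction (x : nat -> nat -> C) :
  (forall k, exists B, forall n, Cmod (x k n) <= B) ->
  exists phi, extraction phi /\ forall k, C_cauchy (fun n => x k (phi n)).
Proof.
  intros HB.
  (* Real parts sit at even indices and imaginary parts at odd ones, so a single real extraction
     serves both. *)
  destruct (diagonal_extraction (fun k n => if Nat.even k then fst (x (Nat.div2 k) n)
                                           else snd (x (Nat.div2 k) n))) as (phi & H1 & H2).
  - intros k. destruct (HB (Nat.div2 k)) as [B HBk]. exists B. intros n.
    assert (X := Cmod_components (x (Nat.div2 k) n)). specialize (HBk n).
    destruct (Nat.even k); lra.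
  - exists phi. split; auto. intros k.
    destruct (H2 (2 * k)%nat) as [a Ha]. destruct (H2 (S (2 * k))%nat) as [b Hb].
    rewrite Nat.even_mul, Nat.div2_double in Ha. simpl orb in Ha. cbv iota in Ha.
    rewrite Nat.even_succ, Nat.odd_mul, Nat.div2_succ_double in Hb. simpl andb in Hb. cbv iota in Hb.
    apply C_cv_cauchy with (a, b). apply C_cv_of_components; auto.
Qed.

(** * Analyticity of the derivative, and the derivative of S_g f *)

Lemma der_local h k z l rho : 0 < rho -> (forall u, Cmod (u - z) < rho -> h u = k u) ->
  der_at idC h z l -> der_at idC k z l.
Proof.
  intros Hrho E H. apply little_o_der; [unfold idC; intros; subst; auto|].
  intros eps He. destruct (der_little_o _ _ _ _ H eps He) as (d & Hd & K).
  exists (Rmin d rho). split; [apply Rmin_pos; auto|]. unfold idC in *. intros u Hu.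
  rewrite <- (E u), <- (E z).
  - apply K. eapply Rlt_le_trans; [exact Hu|apply Rmin_l].
  - replace (z - z)%C with (RtoC 0) by ring. rewrite Cmod_0. auto.
  - eapply Rlt_le_trans; [exact Hu|apply Rmin_r].
Qed.

(** The Cauchy mean with kernel [(v - z)^(-2)] represents [dC f] only on the disc of radius [s], so
    its derivative is transferred through [der_local]. The numbers [Cmod z], [s], [r], 1 are equally
    spaced. *)
Lemma holoD_dC f : holoD f -> holoD (dC f).
Proof.
  intros Hf z Hz. unfold inD in Hz. assert (P := Cmod_ge_0 z).
  set (s := (1 + 2 * Cmod z) / 3). set (r := (2 + Cmod z) / 3).
  destruct (circle_bounded f r Hf) as (M & _ & HM); [unfold r; lra|].
  assert (Hsr : 0 <= s < r) by (unfold s, r; lra). assert (Hr : r < 1) by (unfold r; lra).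
  assert (Hzs : Cmod z < s) by (unfold s; lra).
  eexists. apply der_is_derive.
  eapply der_local; [| |apply (der_kernel_2 f r s M Hf Hsr Hr HM z Hzs)].
  - apply Rlt_0_minus, Hzs.
  - intros u Hu. symmetry. apply (dC_kernel f r s M Hf Hsr Hr HM).
    assert (X := Cmod_sub_ge u z). lra.
Qed.

Lemma holoD_mult f g : holoD f -> holoD g -> holoD (fun z => f z * g z)%C.
Proof.
  intros Hf Hg. eapply der_holoD. intros z Hz.
  apply (der_mult idC f g); apply holoD_der; auto.
Qed.

Lemma der_minus_holoD f g z : holoD f -> holoD g -> inD z ->
  der_at idC (fun z => f z - g z)%C z (dC f z - dC g z).
Proof. intros Hf Hg Hz. apply der_minus; apply holoD_der; auto. Qed.

Lemma holoD_minus f g : holoD f -> holoD g -> holoD (fun z => f z - g z)%C.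
Proof. intros Hf Hg. eapply der_holoD. intros z Hz. apply der_minus_holoD; auto. Qed.

Lemma dC_minus f g z : holoD f -> holoD g -> inD z ->
  dC (fun z => f z - g z)%C z = (dC f z - dC g z)%C.
Proof. intros Hf Hg Hz. apply dC_eq, der_minus_holoD; auto. Qed.

Lemma Sg_der g f z : holoD g -> holoD f -> inD z -> der_at idC (Sg g f) z (dC f z * g z).
Proof.
  intros Hg Hf Hz. apply (ray_primitive_der (fun w => dC f w * g w)%C); auto.
  apply holoD_mult; auto. apply holoD_dC; auto.
Qed.

Lemma holoD_Sg g f : holoD g -> holoD f -> holoD (Sg g f).
Proof. intros Hg Hf. eapply der_holoD. intros z Hz. apply Sg_der; auto. Qed.

Lemma dC_Sg g f z : holoD g -> holoD f -> inD z -> dC (Sg g f) z = (dC f z * g z)%C.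
Proof. intros Hg Hf Hz. apply dC_eq, Sg_der; auto. Qed.

(** This removes the value at 0 from [Bnorm_le] when two images are compared. *)
Lemma Sg_0 g f : Sg g f 0 = 0%C.
Proof.
  unfold Sg. rewrite (RInt_C_ext _ (fun _ => RtoC 0)); [|lra|].
  - rewrite (RInt_C_unique _ _ _ _ (is_RInt_C_const 0 1 (RtoC 0))). ring.
  - intros t _. eqC. ring.
Qed.

(** The estimates above are centred at 0, so the disc about [z] of radius [1 - Cmod z] is first
    rescaled to the unit disc. Radii 1/2 and 1/4 give [(1/2) / (1/4)^2 = 8], and the circle of
    radius 1/2 corresponds to points of modulus at most [(1 + Cmod z) / 2]. *)
Lemma local_derivative_bound f z M : holoD f -> inD z ->
  (forall w, Cmod w <= (1 + Cmod z) / 2 -> Cmod (f w) <= M) ->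
  Cmod (dC f z) * (1 - Cmod z) <= 8 * M.
Proof.
  intros Hf Hz HM. unfold inD in Hz. assert (P := Cmod_ge_0 z).
  set (d := 1 - Cmod z). assert (Hd : 0 < d) by (unfold d; lra).
  set (F := fun u : C => f (z + d * u)%C).
  assert (Hin : forall u : C, Cmod (z + d * u) <= Cmod z + d * Cmod u).
  { intros u. eapply Rle_trans; [apply Cmod_triangle|].
    rewrite Cmod_mult, Cmod_R, Rabs_right by lra. lra. }
  assert (DF : forall u, inD u -> der_at idC F u (dC f (z + d * u) * d)%C).
  { intros u Hu. apply (der_comp idC f (fun u => z + d * u)%C).
    - apply holoD_der; auto. unfold inD in *. eapply Rle_lt_trans; [apply Hin|]. unfold d in *. nra.
    - apply der_eq with (0 + d * 1)%C; [|ring].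
      apply der_plus; [apply der_const|apply der_scal, der_emb]. }
  assert (HF : holoD F) by (eapply der_holoD; exact DF).
  assert (X := cauchy_derivative_bound F (1 / 2) (1 / 4) M HF ltac:(lra) ltac:(lra)).
  assert (D0 : inD 0) by (unfold inD; rewrite Cmod_0; lra).
  specialize (X ltac:(intros t Ht; apply HM; eapply Rle_trans; [apply Hin|];
    rewrite Cmod_circ by lra; unfold d; lra) 0%C ltac:(rewrite Cmod_0; lra)).
  rewrite (dC_eq _ _ _ (DF 0%C D0)), Cmod_mult, Cmod_R, Rabs_right in X by lra.
  replace (z + d * 0)%C with z in X by ring. lra.
Qed.

(** * Montel's theorem *)

(** The Taylor coefficient of index [k] at 0, read on the circle of radius [r]; the extraction below
    runs over pairs of a radius and an index. *)
Definition coef (r : R) (k : nat) (f : C -> C) : C := circle_mean r (fun v => f v * (/ v) ^ k)%C.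

Lemma coef_cont f r k v : holoD f -> 0 < r < 1 -> Cmod v = r ->
  cont_at idC (fun v => f v * (/ v) ^ k)%C v.
Proof.
  intros Hf Hr Hv. assert (cont_at idC f v) by (apply cont_holoD; unfold inD; auto; lra).
  cont_kernel. apply Cmod_neq0. lra.
Qed.

Lemma coef_bound f r k M : holoD f -> 0 < r < 1 ->
  (forall t, 0 <= t <= 1 -> Cmod (f (circ r t)) <= M) -> Cmod (coef r k f) <= M * (/ r) ^ k.
Proof.
  intros Hf Hr HM. apply (circle_mean_bound r (fun v => f v * (/ v) ^ k)%C); [lra| |].
  - intros v Hv. apply (coef_cont f r k v Hf Hr Hv).
  - intros t Ht. assert (E : Cmod (circ r t) = r) by (apply Cmod_circ; lra).
    rewrite Cmod_mult, Cmod_pow, Cmod_inv, E by (apply Cmod_neq0; lra).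
    apply Rmult_le_compat_r; auto. apply pow_le, Rlt_le, Rinv_0_lt_compat. lra.
Qed.

Lemma coef_minus f g r k : holoD f -> holoD g -> 0 < r < 1 ->
  coef r k (fun z => f z - g z)%C = (coef r k f - coef r k g)%C.
Proof.
  intros Hf Hg Hr. apply RInt_C_unique.
  refine (is_RInt_C_ext _ _ _ _ _ Rle_0_1 _ (is_RInt_C_minus _ _ _ _ _ _
    (circle_mean_correct r (fun v => f v * (/ v) ^ k)%C _ _)
    (circle_mean_correct r (fun v => g v * (/ v) ^ k)%C _ _))); try lra.
  - intros t _. eqC. ring.
  - intros v Hv. apply (coef_cont _ r); auto.
  - intros v Hv. apply (coef_cont _ r); auto.
Qed.

Definition circle_bounded_family (fs : nat -> C -> C) : Prop :=
  forall r, 0 <= r < 1 -> exists M, forall n t, 0 <= t <= 1 -> Cmod (fs n (circ r t)) <= M.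

(** The Taylor remainder is applied to the differences [fs n - fs m], bounded by [2 * M] on the
    circle. First [n0] makes the geometric tail at most [eps / 2]; then only [n0] coefficients have
    to be close. *)
Lemma uniformly_cauchy_of_coef fs r s M : (forall n, holoD (fs n)) -> 0 <= s < r -> r < 1 ->
  (forall n t, 0 <= t <= 1 -> Cmod (fs n (circ r t)) <= M) ->
  (forall k, C_cauchy (fun n => coef r k (fs n))) ->
  forall eps, 0 < eps -> exists N, forall n m z, (N <= n)%nat -> (N <= m)%nat -> Cmod z <= s ->
    Cmod (fs n z - fs m z) <= eps.
Proof.
  intros Hf Hs Hr HM Hc eps He.
  assert (M0 : 0 <= M) by (eapply Rle_trans; [apply Cmod_ge_0|apply (HM O 0); lra]).
  set (A := 2 * M * r * / (r - s)).
  assert (HA : 0 <= A).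
  { unfold A. apply Rmult_le_pos; [apply Rmult_le_pos; lra|].
    apply Rlt_le, Rinv_0_lt_compat. lra. }
  destruct (pow_lt_1_zero (s / r)) with (y := eps / (2 * (A + 1))) as [n0 Hn0].
  { rewrite Rabs_right; [|apply Rle_ge, Rdiv_le_0_compat; lra].
    apply Rmult_lt_reg_r with r; [lra|]. unfold Rdiv. rewrite Rmult_assoc, Rinv_l; lra. }
  { apply Rdiv_lt_0_compat; lra. }
  specialize (Hn0 n0 (le_n n0)).
  rewrite Rabs_right in Hn0 by (apply Rle_ge, pow_le, Rdiv_le_0_compat; lra).
  set (eta := eps / (2 * (INR n0 + 1))).
  assert (Pn0 := pos_INR n0).
  assert (Heta : 0 < eta) by (unfold eta; apply Rdiv_lt_0_compat; lra).
  assert (HN : exists N, forall k n m, (k < n0)%nat -> (N <= n)%nat -> (N <= m)%nat ->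
     Cmod (coef r k (fs n) - coef r k (fs m)) <= eta).
  { generalize n0. intros k0. induction k0 as [|k0 [N1 H1]].
    - exists O. intros; lia.
    - destruct (Hc k0 eta Heta) as [N2 H2]. exists (max N1 N2). intros k n m Hk Hn Hm.
      destruct (Nat.eq_dec k k0) as [->|D]; [apply H2; lia|apply H1; lia]. }
  destruct HN as [N HN]. exists N. intros n m z Hn Hm Hz.
  assert (X := cauchy_taylor_remainder (fun z => fs n z - fs m z)%C r s (2 * M)
     (holoD_minus _ _ (Hf n) (Hf m)) Hs Hr).
  eapply Rle_trans.
  - apply (X ltac:(intros t Ht; eapply Rle_trans; [apply Cmod_sub_le|];
      assert (Y1 := HM n t Ht); assert (Y2 := HM m t Ht); lra) z n0 eta Hz).
    intros k Hk. change (Cmod (coef r k (fun z => fs n z - fs m z)%C) <= eta).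
    rewrite coef_minus by (auto; lra). apply HN; auto.
  - replace (2 * M * r * ((s / r) ^ n0 * / (r - s))) with (A * (s / r) ^ n0) by (unfold A; ring).
    assert (E1 : INR n0 * eta <= eps / 2).
    { apply Rle_trans with ((INR n0 + 1) * eta); [nra|]. right. unfold eta. field. lra. }
    assert (E2 : A * (s / r) ^ n0 <= eps / 2).
    { apply Rle_trans with ((A + 1) * (eps / (2 * (A + 1)))).
      - assert (0 <= (s / r) ^ n0) by (apply pow_le, Rdiv_le_0_compat; lra). nra.
      - right. field. lra. }
    lra.
Qed.

Lemma C_cv_minus u v a b : C_cv u a -> C_cv v b -> C_cv (fun n => u n - v n)%C (a - b)%C.
Proof.
  intros H K eps He. destruct (H (eps / 2)) as [N1 H1]; [lra|]. destruct (K (eps / 2)) as [N2 H2]; [lra|].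
  exists (max N1 N2). intros n Hn.
  replace (u n - v n - (a - b))%C with ((u n - a) - (v n - b))%C by ring.
  assert (X := Cmod_sub_le (u n - a) (v n - b)).
  specialize (H1 n ltac:(lia)). specialize (H2 n ltac:(lia)). lra.
Qed.

Lemma C_cv_scal c u a : C_cv u a -> C_cv (fun n => c * u n)%C (c * a)%C.
Proof.
  intros H eps He. assert (P := Cmod_ge_0 c).
  destruct (H (eps / (Cmod c + 1))) as [N HN]; [apply Rdiv_lt_0_compat; lra|].
  exists N. intros n Hn. specialize (HN n Hn).
  replace (c * u n - c * a)%C with (c * (u n - a))%C by ring. rewrite Cmod_mult.
  replace eps with ((Cmod c + 1) * (eps / (Cmod c + 1))) by (field; lra).
  apply Rmult_le_compat; auto using Cmod_ge_0; lra.
Qed.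

Lemma C_cv_eventual_bound u l c B N : C_cv u l -> (forall n, (N <= n)%nat -> Cmod (u n - c) <= B) ->
  Cmod (l - c) <= B.
Proof.
  intros H HB. apply (C_cv_bound (fun n => u (N + n)%nat)).
  - intros eps He. destruct (H eps He) as [N' HN']. exists N'. intros n Hn. apply HN'. lia.
  - intros n. apply HB. lia.
Qed.

(** The coefficients on a sequence of circles tending to the boundary are extracted diagonally,
    which makes the subsequence uniformly Cauchy on every smaller disc. Cauchy's estimate for
    differences carries this over to the derivatives. *)
Theorem montel fs : (forall n, holoD (fs n)) -> circle_bounded_family fs ->
  exists phi f, extraction phi /\ holoD f /\
    (forall z, inD z -> C_cv (fun n => fs (phi n) z) (f z)) /\
    (forall s, 0 <= s < 1 -> forall eps, 0 < eps -> exists N, forall n z, (N <= n)%nat -> Cmod z < s ->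
       Cmod (dC (fs (phi n)) z - dC f z) <= eps).
Proof.
  intros Hf HB.
  (* The radii start at 1/2, so they are positive, and increase to 1. *)
  set (rad := fun j => 1 - / INR (S (S j))).
  assert (Hrad : forall j, 0 < rad j < 1).
  { intros j. unfold rad. assert (X : 1 < INR (S (S j))).
    { apply (lt_INR 1). lia. }
    assert (Y : 0 < / INR (S (S j))) by (apply Rinv_0_lt_compat; lra).
    assert (Z : / INR (S (S j)) < 1) by (rewrite <- Rinv_1; apply Rinv_lt_contravar; lra). lra. }
  destruct (C_diagonal_extraction
    (fun p n => coef (rad (fst (Cantor.of_nat p))) (snd (Cantor.of_nat p)) (fs n))) as (phi & Hphi & Hc).
  { intros p. destruct (HB (rad (fst (Cantor.of_nat p)))) as [M HM].
    - destruct (Hrad (fst (Cantor.of_nat p))). lra.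
    - eexists. intros n. apply coef_bound; auto. }
  set (u := fun n => fs (phi n)). assert (Hu : forall n, holoD (u n)) by (intros; apply Hf).
  assert (HBu : circle_bounded_family u).
  { intros r Hr. destruct (HB r Hr) as [M HM]. exists M. intros n. apply HM. }
  assert (UC : forall s, 0 <= s < 1 -> forall eps, 0 < eps -> exists N, forall n m z,
     (N <= n)%nat -> (N <= m)%nat -> Cmod z <= s -> Cmod (u n z - u m z) <= eps).
  { intros s Hs. destruct (archimed_cor1 (1 - s)) as (j & Hj & Hj0); [lra|].
    assert (Hsj : 0 <= s < rad j).
    { unfold rad. assert (X : / INR (S (S j)) <= / INR j).
      { apply Rinv_le_contravar; [apply lt_0_INR; auto|apply le_INR; lia]. } lra. }
    destruct (HBu (rad j)) as [M HM]; [destruct (Hrad j); lra|].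
    apply (uniformly_cauchy_of_coef u (rad j) s M); auto; [apply Hrad|].
    intros k. specialize (Hc (Cantor.to_nat (j, k))). rewrite Cantor.cancel_of_to in Hc. exact Hc. }
  assert (UCd : forall s, 0 <= s < 1 -> forall eps, 0 < eps -> exists N, forall n m z,
     (N <= n)%nat -> (N <= m)%nat -> Cmod z < s -> Cmod (dC (u n) z - dC (u m) z) <= eps).
  { intros s Hs eps He. set (r := (1 + s) / 2). assert (Hr : s < r < 1) by (unfold r; lra).
    set (A := r * / (r - s) ^ 2).
    assert (HA : 0 < A).
    { unfold A. apply Rmult_lt_0_compat; [lra|]. apply Rinv_0_lt_compat, pow_lt. lra. }
    destruct (UC r ltac:(lra) (eps / A)) as [N HN]; [apply Rdiv_lt_0_compat; auto|].
    exists N. intros n m z Hn Hm Hz. rewrite <- dC_minus by (auto; unfold inD; lra).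
    replace eps with (eps / A * r * / (r - s) ^ 2)
      by (rewrite Rmult_assoc; fold A; field; lra).
    apply (cauchy_derivative_bound (fun z => u n z - u m z)%C r s (eps / A)); auto; try lra.
    - apply holoD_minus; auto.
    - intros t Ht. apply HN; auto. rewrite Cmod_circ; lra. }
  assert (Hlim : forall z, exists p : C * C, inD z ->
    C_cv (fun n => u n z) (fst p) /\ C_cv (fun n => dC (u n) z) (snd p)).
  { intros z. destruct (classic (inD z)) as [Hz|Hz]; [|exists (RtoC 0, RtoC 0); tauto].
    assert (P := Cmod_ge_0 z). unfold inD in Hz.
    destruct (C_complete (fun n => u n z)) as [a Ha].
    { intros eps He. destruct (UC (Cmod z) ltac:(lra) eps He) as [N HN]. exists N. intros. apply HN; auto; lra. }
    destruct (C_complete (fun n => dC (u n) z)) as [b Hb].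
    { intros eps He. destruct (UCd ((1 + Cmod z) / 2) ltac:(lra) eps He) as [N HN].
      exists N. intros. apply HN; auto; lra. }
    exists (a, b). auto. }
  apply functional_choice in Hlim. destruct Hlim as [lim Hlim].
  set (f := fun z => fst (lim z)). set (F := fun z => snd (lim z)).
  assert (Df : forall z, inD z -> der_at idC f z (F z)).
  { intros z Hz. assert (P := Cmod_ge_0 z). assert (Hz' := Hz). unfold inD in Hz'.
    set (s := (1 + 2 * Cmod z) / 3). set (r := (2 + Cmod z) / 3).
    assert (Hsr : 0 <= s < r) by (unfold s, r; lra). assert (Hr : r < 1) by (unfold r; lra).
    assert (Hzs : Cmod z < s) by (unfold s; lra).
    destruct (HBu r ltac:(lra)) as [M HM].
    assert (M0 : 0 <= M) by (eapply Rle_trans; [apply Cmod_ge_0|apply (HM O 0); lra]).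
    (* This constant is the same for all members of the sequence, so the quadratic remainder passes
       to the pointwise limit and identifies [F z] as the derivative. *)
    apply little_o_of_quadratic with (M * r * / (r - s) ^ 3) (s - Cmod z).
    - apply Rmult_le_pos; [apply Rmult_le_pos; lra|]. apply Rlt_le, Rinv_0_lt_compat, pow_lt; lra.
    - lra.
    - intros w Hw. assert (Hws : Cmod w <= s) by (assert (Y := Cmod_sub_ge w z); lra).
      assert (Dw : inD w) by (unfold inD; lra).
      replace (f w - f z - (w - z) * F z)%C with (f w - f z - (w - z) * F z - 0)%C by ring.
      apply (C_cv_bound (fun n => u n w - u n z - (w - z) * dC (u n) z)%C).
      + apply C_cv_minus; [apply C_cv_minus|apply C_cv_scal]; apply Hlim; auto.
      + intros n. replace (u n w - u n z - (w - z) * dC (u n) z - 0)%C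
          with (u n (z + (w - z))%C - u n z - (w - z) * dC (u n) z)%C
          by (replace (z + (w - z))%C with w by ring; ring).
        apply (cauchy_second_order (u n) r s M); auto.
        replace (z + (w - z))%C with w by ring. auto. }
  exists phi, f. split; [auto|split; [|split]].
  - eapply der_holoD, Df.
  - intros z Hz. apply Hlim, Hz.
  - intros s Hs eps He. destruct (UCd s Hs eps He) as [N HN]. exists N. intros n z Hn Hz.
    assert (Dz : inD z) by (unfold inD; lra).
    rewrite (dC_eq _ _ _ (Df z Dz)), Cmod_minus_sym.
    apply (C_cv_eventual_bound (fun m => dC (u m) z) _ _ _ N); [apply Hlim, Dz|].
    intros m Hm. apply HN; auto.
Qed.

(** * Weights with property (U) *)

(* Enlarging the exponent in property (U) keeps it valid, so the exponent may be taken to be an integer. *)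
Definition regular_weight (nu : C -> R) (n : nat) (K : R) : Prop :=
  weight nu /\ 0 < K /\ (forall z, inD z -> 0 < nu z) /\
  forall z w, inD z -> inD w -> Cmod z <= Cmod w ->
    nu z * (1 - Cmod w ^ 2) ^ n <= K * nu w * (1 - Cmod z ^ 2) ^ n.

Lemma one_minus_sqr_pos z : inD z -> 0 < 1 - Cmod z ^ 2.
Proof. unfold inD. intros H. assert (P := Cmod_ge_0 z). nra. Qed.

Lemma inD_0 : inD 0.
Proof. unfold inD. rewrite Cmod_0. lra. Qed.

(** The factor [(1 - r ^ 2) ^ (n - alpha)] decreases in [r] for [n > alpha], so it can be multiplied
    into the cross-multiplied inequality. The condition [0 < nu 0] excludes the zero weight, for
    which the quotient in (2) has no meaning. *)
Lemma propU_regular nu : weight nu -> propU nu -> 0 < nu 0 -> exists n K, regular_weight nu n K.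
Proof.
  intros Hw (alpha & Ha & K & HK & HU) H0.
  destruct (INR_unbounded alpha) as [n Hn].
  assert (Hreg : forall z w, inD z -> inD w -> Cmod z <= Cmod w ->
    nu z * (1 - Cmod w ^ 2) ^ n <= K * nu w * (1 - Cmod z ^ 2) ^ n).
  { intros z w Hz Hw' Hzw. destruct Hw as (Hnn & _ & Hrad & _).
    assert (Rad : forall v, inD v -> nu v = nu (RtoC (Cmod v))).
    { intros v Hv. apply Hrad; auto; [unfold inD|]; rewrite Cmod_R, Rabs_right by (apply Rle_ge, Cmod_ge_0);
        auto. }
    rewrite (Rad z Hz), (Rad w Hw').
    specialize (HU (Cmod z) (Cmod w) (Cmod_ge_0 z) Hzw Hw').
    assert (Px := one_minus_sqr_pos z Hz). assert (Py := one_minus_sqr_pos w Hw').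
    assert (Hxy : 1 - Cmod w ^ 2 <= 1 - Cmod z ^ 2) by (assert (X := Cmod_ge_0 z); nra).
    set (x := 1 - Cmod z ^ 2) in *. set (y := 1 - Cmod w ^ 2) in *.
    set (a := nu (RtoC (Cmod z))) in *. set (b := nu (RtoC (Cmod w))) in *.
    assert (Qx : 0 < Rpower x alpha) by apply exp_pos. assert (Qy : 0 < Rpower y alpha) by apply exp_pos.
    assert (Ex : x ^ n = Rpower x alpha * Rpower x (INR n - alpha)).
    { rewrite <- Rpower_plus, <- Rpower_pow by auto. f_equal. ring. }
    assert (Ey : y ^ n = Rpower y alpha * Rpower y (INR n - alpha)).
    { rewrite <- Rpower_plus, <- Rpower_pow by auto. f_equal. ring. }
    assert (L : Rpower y (INR n - alpha) <= Rpower x (INR n - alpha)) by (apply Rle_Rpower_l; lra).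
    assert (Ry : 0 < Rpower y (INR n - alpha)) by apply exp_pos.
    assert (M : a * Rpower y alpha <= K * b * Rpower x alpha).
    { apply Rmult_le_compat_r with (r := Rpower x alpha * Rpower y alpha) in HU; [|nra].
      replace (a / Rpower x alpha * (Rpower x alpha * Rpower y alpha)) with (a * Rpower y alpha)
        in HU by (field; lra).
      replace (K * (b / Rpower y alpha) * (Rpower x alpha * Rpower y alpha)) with (K * b * Rpower x alpha)
        in HU by (field; lra). exact HU. }
    assert (A0 : 0 <= b).
    { unfold b. rewrite <- Rad; auto. }
    rewrite Ex, Ey, <- !Rmult_assoc. apply Rle_trans with (K * b * Rpower x alpha * Rpower y (INR n - alpha)).
    - apply Rmult_le_compat_r; lra.
    - apply Rmult_le_compat_l; auto. apply Rmult_le_pos; [apply Rmult_le_pos; lra|lra]. }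
  exists n, K. split; [auto|split; [auto|split; auto]].
  (* Positivity spreads from the origin: between 0 and [z] the inequality reads
     [nu 0 * (1 - Cmod z ^ 2) ^ n <= K * nu z]. *)
  intros z Hz. apply Rnot_le_lt. intros L.
  specialize (Hreg 0%C z inD_0 Hz). rewrite Cmod_0 in Hreg. specialize (Hreg (Cmod_ge_0 z)).
  assert (P := pow_lt _ n (one_minus_sqr_pos z Hz)).
  replace ((1 - 0 ^ 2) ^ n) with 1 in Hreg by (rewrite <- (pow1 n) at 1; f_equal; ring).
  assert (0 < nu 0 * (1 - Cmod z ^ 2) ^ n) by (apply Rmult_lt_0_compat; auto). nra.
Qed.

Lemma holoD_bounded f r : holoD f -> r < 1 -> exists M, 0 < M /\ forall z, Cmod z <= r -> Cmod (f z) <= M.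
Proof.
  (* A radius supplied by [lim_bdry0] may be negative, whereas the Cauchy estimates need a
     nonnegative one. *)
  intros Hf Hr. set (s := Rmax r 0). assert (Hs : 0 <= s < 1).
  { unfold s. split; [apply Rmax_r|apply Rmax_lub_lt; lra]. }
  destruct (circle_bounded f ((1 + s) / 2) Hf) as (M & HM0 & HM); [lra|].
  eexists. split; cycle 1.
  - intros z Hz. apply (cauchy_value_bound f ((1 + s) / 2) s M); auto; try lra.
    apply Rle_trans with (1 := Hz). apply Rmax_l.
  - apply Rmult_lt_0_compat; [apply Rmult_lt_0_compat; lra|]. apply Rinv_0_lt_compat. lra.
Qed.

Lemma weight_le_0 nu z : weight nu -> inD z -> 0 <= nu z <= nu 0.
Proof.
  intros (H1 & _ & _ & H2) Hz. split; auto. apply H2; auto using inD_0.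
  rewrite Cmod_0. apply Cmod_ge_0.
Qed.

Lemma weighted_bound_of_lim_bdry0 mu f : weight mu -> holoD f ->
  lim_bdry0 (fun z => mu z * Cmod (f z)) ->
  exists M, forall z, inD z -> mu z * Cmod (f z) <= M.
Proof.
  intros Hmu Hf Hlim. destruct (Hlim 1 Rlt_0_1) as (r & Hr & H).
  destruct (holoD_bounded f r Hf Hr) as (M & HM0 & HM).
  assert (P := weight_le_0 mu 0%C Hmu inD_0).
  exists (1 + mu 0 * M). intros z Hz. assert (Q := weight_le_0 mu z Hmu Hz).
  assert (0 <= mu 0 * M) by (apply Rmult_le_pos; lra).
  destruct (Rle_dec (Cmod z) r) as [L|L].
  - assert (mu z * Cmod (f z) <= mu 0 * M); [|lra].
    apply Rmult_le_compat; try lra; [apply Cmod_ge_0|auto].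
  - specialize (H z Hz ltac:(lra)). apply Rabs_def2 in H. lra.
Qed.

(** At [s = (1 + Cmod z) / 2] one has [1 - Cmod z ^ 2 <= 4 * (1 - s ^ 2)], so property (U) bounds
    [nu z] by [K * 4 ^ n] times the smallest value of [nu] on the disc used. The 16 is the 8 of the
    local estimate times 2, from [1 + Cmod z <= 2]. *)
Lemma holoD_hinf_derivative nu n K f M z : regular_weight nu n K -> holoD f -> Hnorm_le nu f M -> inD z ->
  Cmod (dC f z) * ((1 - Cmod z ^ 2) * nu z) <= 16 * K * 4 ^ n * M.
Proof.
  intros (Hw & HK & Hpos & Hreg) Hf HM Hz.
  assert (P := Cmod_ge_0 z). assert (Hz' := Hz). unfold inD in Hz'.
  assert (Hnz := Hpos z Hz).
  set (s := (1 + Cmod z) / 2). assert (Hs : Cmod z <= s < 1) by (unfold s; lra).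
  assert (Es : Cmod (RtoC s) = s) by (rewrite Cmod_R, Rabs_right; lra).
  assert (Ds : inD (RtoC s)) by (unfold inD; lra).
  assert (X := Hreg z (RtoC s) Hz Ds ltac:(lra)). rewrite Es in X.
  assert (Q : (1 - Cmod z ^ 2) ^ n <= 4 ^ n * (1 - s ^ 2) ^ n).
  { rewrite <- Rpow_mult_distr. apply pow_incr. split.
    - apply Rlt_le, one_minus_sqr_pos, Hz.
    - unfold s. nra. }
  assert (Ps : 0 < (1 - s ^ 2) ^ n) by (apply pow_lt; nra).
  assert (P4 : 0 < 4 ^ n) by (apply pow_lt; lra).
  assert (Y : nu z <= K * 4 ^ n * nu (RtoC s)).
  { apply Rmult_le_reg_r with (1 := Ps). apply Rle_trans with (1 := X).
    replace (K * 4 ^ n * nu (RtoC s) * (1 - s ^ 2) ^ n) with (K * nu (RtoC s) * (4 ^ n * (1 - s ^ 2) ^ n)) by ring.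
    apply Rmult_le_compat_l; auto. apply Rmult_le_pos; [lra|]. apply Rlt_le; auto. }
  assert (B : Cmod (dC f z) * (1 - Cmod z) <= 8 * (K * 4 ^ n * M / nu z)).
  { apply local_derivative_bound; auto. intros w Hws. fold s in Hws.
    assert (Dw : inD w) by (unfold inD; lra).
    assert (Nw : nu (RtoC s) <= nu w) by (apply Hw; auto; lra).
    apply Rmult_le_reg_r with (nu z); auto.
    replace (K * 4 ^ n * M / nu z * nu z) with (K * 4 ^ n * M) by (field; lra).
    assert (PK : 0 < K * 4 ^ n) by (apply Rmult_lt_0_compat; auto).
    assert (Pf := Cmod_ge_0 (f w)).
    apply Rle_trans with (Cmod (f w) * (K * 4 ^ n * nu w)).
    - apply Rmult_le_compat_l; auto. apply Rle_trans with (1 := Y). apply Rmult_le_compat_l; lra.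
    - specialize (HM w Dw). nra. }
  assert (Pd := Cmod_ge_0 (dC f z)).
  apply Rmult_le_compat_r with (r := 2 * nu z) in B; [|lra].
  replace (8 * (K * 4 ^ n * M / nu z) * (2 * nu z)) with (16 * K * 4 ^ n * M) in B by (field; lra).
  apply Rle_trans with (2 := B).
  replace (Cmod (dC f z) * (1 - Cmod z) * (2 * nu z)) with (Cmod (dC f z) * (2 * (1 - Cmod z) * nu z)) by ring.
  apply Rmult_le_compat_l; auto. apply Rmult_le_compat_r; [lra|]. nra.
Qed.

(** * Sufficiency *)

Definition symbol (g : C -> C) (nu mu : C -> R) (z : C) : R :=
  mu z / ((1 - Cmod z ^ 2) * nu z) * Cmod (g z).

Lemma symbol_mult g nu mu n K z : regular_weight nu n K -> inD z ->
  mu z * Cmod (g z) = symbol g nu mu z * ((1 - Cmod z ^ 2) * nu z).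
Proof.
  intros (_ & _ & Hpos & _) Hz. unfold symbol.
  assert (P := one_minus_sqr_pos z Hz). assert (Q := Hpos z Hz). field. split; lra.
Qed.

Lemma symbol_nonneg g nu mu n K z : regular_weight nu n K -> weight mu -> inD z -> 0 <= symbol g nu mu z.
Proof.
  intros (_ & _ & Hpos & _) Hmu Hz. unfold symbol.
  assert (P := one_minus_sqr_pos z Hz). assert (Q := Hpos z Hz). assert (R := weight_le_0 mu z Hmu Hz).
  apply Rmult_le_pos; [|apply Cmod_ge_0]. apply Rdiv_le_0_compat; [lra|]. apply Rmult_lt_0_compat; auto.
Qed.

Lemma weighted_dC_Sg_bound g nu mu n K f M z : regular_weight nu n K -> weight mu ->
  holoD f -> Hnorm_le nu f M -> inD z ->
  mu z * (Cmod (dC f z) * Cmod (g z)) <= symbol g nu mu z * (16 * K * 4 ^ n * M).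
Proof.
  intros Hnu Hmu Hf HM Hz.
  replace (mu z * (Cmod (dC f z) * Cmod (g z))) with (Cmod (dC f z) * (mu z * Cmod (g z))) by ring.
  rewrite (symbol_mult g nu mu n K z Hnu Hz).
  assert (X := holoD_hinf_derivative nu n K f M z Hnu Hf HM Hz).
  assert (P := symbol_nonneg g nu mu n K z Hnu Hmu Hz).
  apply Rmult_le_compat_l with (1 := P) in X. lra.
Qed.

Lemma dC_Sg_vanishes g nu mu n K f M : holoD g -> regular_weight nu n K -> weight mu ->
  lim_bdry0 (symbol g nu mu) -> holoD f -> Hnorm_le nu f M ->
  lim_bdry0 (fun z => mu z * Cmod (dC (Sg g f) z)).
Proof.
  intros Hg Hnu Hmu Hlim Hf HM eps He.
  (* [M] carries no sign; the absolute value and the added 1 make [A] a positive divisor. *)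
  set (A := Rabs (16 * K * 4 ^ n * M) + 1).
  assert (HA : 0 < A) by (assert (X := Rabs_pos (16 * K * 4 ^ n * M)); unfold A; lra).
  destruct (Hlim (eps / A)) as (r & Hr & H); [apply Rdiv_lt_0_compat; auto|].
  exists r. split; auto. intros z Hz Hzr. specialize (H z Hz Hzr).
  assert (P := symbol_nonneg g nu mu n K z Hnu Hmu Hz). rewrite Rabs_right in H by lra.
  assert (Q := weight_le_0 mu z Hmu Hz).
  rewrite dC_Sg, Cmod_mult by auto.
  rewrite Rabs_right.
  - apply Rle_lt_trans with (1 := weighted_dC_Sg_bound g nu mu n K f M z Hnu Hmu Hf HM Hz).
    apply Rle_lt_trans with (symbol g nu mu z * A).
    + apply Rmult_le_compat_l; auto. assert (X := Rle_abs (16 * K * 4 ^ n * M)). unfold A. lra.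
    + apply Rmult_lt_compat_r with (1 := HA) in H.
      replace (eps / A * A) with eps in H by (field; lra). exact H.
  - apply Rle_ge, Rmult_le_pos; [lra|]. apply Rmult_le_pos; apply Cmod_ge_0.
Qed.

Lemma compact_of_symbol g nu mu n K (X Y : (C -> C) -> Prop) :
  holoD g -> regular_weight nu n K -> weight mu ->
  (forall f, X f -> holoD f /\ exists M, Hnorm_le nu f M) ->
  (forall h, holoD h -> lim_bdry0 (fun z => mu z * Cmod (dC h z)) -> Y h) ->
  lim_bdry0 (symbol g nu mu) -> compact_op X nu Y mu (Sg g).
Proof.
  intros Hg Hnu Hmu HX HY Hlim.
  (* Stated for a norm bound instead of [X f], because it is applied to the Montel limit, which is
     not known to lie in [X]. *)
  assert (Hmap : forall f M, holoD f -> Hnorm_le nu f M -> Y (Sg g f)).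
  { intros f M Hf HM. apply HY; [apply holoD_Sg; auto|]. eapply dC_Sg_vanishes; eauto. }
  split.
  - intros f Hf. destruct (HX f Hf) as (Hf' & M & HM). eauto.
  - intros fs Hfs.
    assert (Hh : forall n, holoD (fs n)) by (intros k; apply HX, Hfs).
    assert (Hpos : forall z, inD z -> 0 < nu z) by apply Hnu.
    assert (Hval : forall k z, inD z -> Cmod (fs k z) <= / nu z).
    { intros k z Hz. assert (P := Hpos z Hz). apply Rmult_le_reg_l with (1 := P).
      rewrite Rinv_r by lra. apply (Hfs k), Hz. }
    destruct (montel fs Hh) as (phi & f & Hphi & Hf & Hcv & Hdcv).
    { intros r Hr. exists (/ nu (RtoC r)). intros k t Ht.
      assert (Dc : inD (circ r t)) by (unfold inD; rewrite Cmod_circ; lra).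
      assert (Dr : inD (RtoC r)) by (unfold inD; rewrite Cmod_R, Rabs_right; lra).
      replace (nu (RtoC r)) with (nu (circ r t)); auto.
      apply Hnu; auto. rewrite Cmod_circ, Cmod_R, Rabs_right; lra. }
    assert (Hf1 : Hnorm_le nu f 1).
    { intros z Hz. assert (P := Hpos z Hz).
      replace 1 with (nu z * / nu z) by (field; lra). apply Rmult_le_compat_l; [lra|].
      replace (f z) with (f z - 0)%C by ring.
      apply (C_cv_bound _ _ _ _ (Hcv z Hz)). intros k.
      replace (fs (phi k) z - 0)%C with (fs (phi k) z) by ring. auto. }
    exists phi, (Sg g f). split; [exact Hphi|split; [eauto|]].
    intros eps He. set (A := 16 * K * 4 ^ n).
    assert (HA : 0 < A).
    { unfold A. destruct Hnu as (_ & HK & _). assert (0 < 4 ^ n) by (apply pow_lt; lra).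
      apply Rmult_lt_0_compat; lra. }
    destruct (Hlim (eps / (2 * A))) as (r & Hr & Hsmall); [apply Rdiv_lt_0_compat; lra|].
    (* Derivatives converge uniformly on open discs only, so a radius strictly beyond [r] is taken
       to cover [Cmod z <= r]. *)
    set (s := (1 + Rmax r 0) / 2).
    assert (Hrs : r < s /\ 0 <= s < 1).
    { assert (B1 := Rmax_l r 0). assert (B2 := Rmax_r r 0).
      assert (B3 : Rmax r 0 < 1) by (apply Rmax_lub_lt; lra). unfold s. lra. }
    destruct (holoD_bounded g s Hg) as (Mg & HMg & Hgs); [lra|].
    assert (Pmu := weight_le_0 mu 0%C Hmu inD_0).
    (* [mu] may vanish, even at 0; the added 1 keeps the divisor positive. *)
    set (D := (mu 0 + 1) * Mg). assert (HD : 0 < D) by (unfold D; apply Rmult_lt_0_compat; lra).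
    destruct (Hdcv s ltac:(lra) (eps / D)) as [N HN]; [apply Rdiv_lt_0_compat; auto|].
    exists N. intros k Hk z Hz. rewrite !Sg_0.
    replace (0 - 0)%C with (RtoC 0) by ring. rewrite Cmod_0, Rplus_0_l.
    rewrite dC_minus, !dC_Sg by (auto using holoD_Sg).
    assert (Q := weight_le_0 mu z Hmu Hz). assert (Pg := Cmod_ge_0 (g z)).
    replace (dC (fs (phi k)) z * g z - dC f z * g z)%C with ((dC (fs (phi k)) z - dC f z) * g z)%C by ring.
    rewrite Cmod_mult.
    destruct (Rle_dec (Cmod z) r) as [L|L].
    + specialize (HN k z Hk ltac:(lra)). specialize (Hgs z ltac:(lra)).
      replace eps with ((mu 0 + 1) * (eps / D * Mg)) by (unfold D; field; lra).
      apply Rmult_le_compat; [lra| |lra|apply Rmult_le_compat; auto using Cmod_ge_0].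
      apply Rmult_le_pos; apply Cmod_ge_0.
    + specialize (Hsmall z Hz ltac:(lra)).
      assert (P := symbol_nonneg g nu mu n K z Hnu Hmu Hz). rewrite Rabs_right in Hsmall by lra.
      assert (X1 := weighted_dC_Sg_bound g nu mu n K _ 1 z Hnu Hmu (Hh (phi k)) (proj2 (Hfs (phi k))) Hz).
      assert (X2 := weighted_dC_Sg_bound g nu mu n K _ 1 z Hnu Hmu Hf Hf1 Hz).
      rewrite Rmult_1_r in X1, X2. fold A in X1, X2.
      assert (X3 : symbol g nu mu z * A <= eps / 2).
      { replace (eps / 2) with (eps / (2 * A) * A) by (field; lra). apply Rmult_le_compat_r; lra. }
      assert (X4 := Cmod_sub_le (dC (fs (phi k)) z) (dC f z)).
      apply Rle_trans with (mu z * ((Cmod (dC (fs (phi k)) z) + Cmod (dC f z)) * Cmod (g z))); [|lra].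
      apply Rmult_le_compat_l; [lra|]. apply Rmult_le_compat_r; auto.
Qed.

(** * Necessity *)

(** The Szego kernel at [a] divided by its value at [a]: it equals 1 at [z = a], has modulus at most
    2 on the disc, and is of order [1 - Cmod a ^ 2] at a fixed [z]. *)
Definition peak (a z : C) : C := (RtoC (1 - Cmod a ^ 2) * / (1 - Cconj a * z))%C.

(** By property (U), [n] of the [S n] factors pay for the division by [nu a]; the last one is left
    over and supplies the pointwise decay as [a] tends to the boundary. *)
Definition test_function (nu : C -> R) (n : nat) (c : R) (a z : C) : C :=
  (RtoC (c / nu a) * peak a z ^ S n)%C.

Lemma Cmod_peak_denom a z : inD a -> inD z ->
  0 < 1 - Cmod a <= Cmod (1 - Cconj a * z) /\ 0 < 1 - Cmod z <= Cmod (1 - Cconj a * z).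
Proof.
  unfold inD. intros Ha Hz. assert (X := Cmod_sub_ge 1 (Cconj a * z)).
  rewrite Cmod_1, Cmod_mult, Cmod_conj in X.
  assert (P := Cmod_ge_0 a). assert (Q := Cmod_ge_0 z). nra.
Qed.

Lemma Cmod_peak a z : inD a -> inD z ->
  Cmod (peak a z) = (1 - Cmod a ^ 2) * / Cmod (1 - Cconj a * z).
Proof.
  intros Ha Hz. assert (X := Cmod_peak_denom a z Ha Hz). assert (P := one_minus_sqr_pos a Ha).
  unfold peak. rewrite Cmod_mult, Cmod_inv by (apply Cmod_neq0; lra).
  rewrite Cmod_R, Rabs_right by lra. reflexivity.
Qed.

Lemma Cmod_peak_le_2 a z : inD a -> inD z -> Cmod (peak a z) <= 2.
Proof.
  intros Ha Hz. assert (X := Cmod_peak_denom a z Ha Hz). rewrite Cmod_peak by auto.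
  apply Rmult_le_reg_r with (Cmod (1 - Cconj a * z)); [lra|].
  rewrite Rmult_assoc, Rinv_l, Rmult_1_r by lra. assert (P := Cmod_ge_0 a). nra.
Qed.

Lemma Cmod_peak_le_quot a z : inD a -> inD z -> Cmod (peak a z) <= (1 - Cmod a ^ 2) * / (1 - Cmod z).
Proof.
  intros Ha Hz. assert (X := Cmod_peak_denom a z Ha Hz). rewrite Cmod_peak by auto.
  apply Rmult_le_compat_l; [apply Rlt_le, one_minus_sqr_pos, Ha|]. apply Rinv_le_contravar; lra.
Qed.

Definition test_derivative (nu : C -> R) (n : nat) (c : R) (a z : C) : C :=
  (RtoC (c / nu a) * (INR (S n) * peak a z ^ n * (peak a z * (Cconj a * / (1 - Cconj a * z)))))%C.

Lemma der_test_function nu n c a z : inD a -> inD z ->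
  der_at idC (test_function nu n c a) z (test_derivative nu n c a z).
Proof.
  intros Ha Hz. assert (X := Cmod_peak_denom a z Ha Hz).
  assert (N : (1 - Cconj a * z)%C <> 0%C) by (apply Cmod_neq0; lra).
  apply der_scal, der_pow.
  apply der_eq with (RtoC (1 - Cmod a ^ 2)
    * (- (0 - Cconj a * 1) / ((1 - Cconj a * z) * (1 - Cconj a * z))))%C.
  - apply der_scal, (der_inv idC (fun z => 1 - Cconj a * z)%C); auto.
    apply der_minus; [apply der_const|]. apply der_scal, der_emb.
  - unfold peak. field. auto.
Qed.

Section TestFunctions.

Variables (nu : C -> R) (n : nat) (K : R).
Hypothesis Hnu : regular_weight nu n K.
Let c := / (2 ^ S n * (K + 1)).

Lemma test_const_pos : 0 < c.
Proof.
  unfold c. destruct Hnu as (_ & HK & _). apply Rinv_0_lt_compat, Rmult_lt_0_compat; [|lra].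
  apply pow_lt. lra.
Qed.

Lemma test_scale_pos a : inD a -> 0 < c / nu a.
Proof. intros Ha. destruct Hnu as (_ & _ & Hpos & _). apply Rdiv_lt_0_compat; auto using test_const_pos. Qed.

Lemma Cmod_test_function a z : inD a -> Cmod (test_function nu n c a z) = c / nu a * Cmod (peak a z) ^ S n.
Proof.
  intros Ha. assert (P := test_scale_pos a Ha). unfold test_function.
  rewrite Cmod_mult, Cmod_pow, Cmod_R, Rabs_right by lra. reflexivity.
Qed.

Lemma test_function_bounded a z : inD a -> inD z ->
  Cmod (test_function nu n c a z) <= c / nu a * 2 ^ S n.
Proof.
  intros Ha Hz. rewrite Cmod_test_function by auto. apply Rmult_le_compat_l.
  - apply Rlt_le, test_scale_pos, Ha.
  - apply pow_incr. split; [apply Cmod_ge_0|apply Cmod_peak_le_2; auto].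
Qed.

(** For [Cmod z <= Cmod a], property (U) costs a ratio of powers that is absorbed by [Cmod (peak a
    z) * (1 - Cmod z ^ 2) <= 2 * (1 - Cmod a ^ 2)], raised to the power [n]. Farther out,
    monotonicity gives [nu z <= nu a]. The factor [K + 1] dominates the constants [K] and 1 of the
    two cases and explains the normalisation [c]. *)
Lemma weighted_peak_bound a z : inD a -> inD z -> nu z * Cmod (peak a z) ^ S n <= 2 ^ S n * (K + 1) * nu a.
Proof.
  intros Ha Hz. destruct Hnu as (Hw & HK & Hpos & Hreg).
  assert (Pz := Hpos z Hz). assert (Pa := Hpos a Ha).
  assert (Q := Cmod_ge_0 (peak a z)). assert (Q2 := Cmod_peak_le_2 a z Ha Hz).
  assert (T : 0 < 2 ^ n) by (apply pow_lt; lra).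
  destruct (Rle_dec (Cmod z) (Cmod a)) as [L|L].
  - specialize (Hreg z a Hz Ha L).
    assert (Xa := one_minus_sqr_pos a Ha). assert (Xz := one_minus_sqr_pos z Hz).
    assert (A : Cmod (peak a z) * (1 - Cmod z ^ 2) <= 2 * (1 - Cmod a ^ 2)).
    { assert (B := Cmod_peak_le_quot a z Ha Hz). unfold inD in Hz.
      apply Rmult_le_compat_r with (r := 1 - Cmod z ^ 2) in B; [|lra].
      apply Rle_trans with (1 := B).
      replace ((1 - Cmod a ^ 2) * / (1 - Cmod z) * (1 - Cmod z ^ 2))
        with ((1 + Cmod z) * (1 - Cmod a ^ 2)) by (field; lra).
      apply Rmult_le_compat_r; lra. }
    assert (An : Cmod (peak a z) ^ n * (1 - Cmod z ^ 2) ^ n <= 2 ^ n * (1 - Cmod a ^ 2) ^ n).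
    { rewrite <- !Rpow_mult_distr. apply pow_incr. split; auto. apply Rmult_le_pos; lra. }
    assert (Pn : 0 < (1 - Cmod z ^ 2) ^ n) by (apply pow_lt; auto).
    assert (B : nu z * Cmod (peak a z) ^ n <= 2 ^ n * K * nu a).
    { apply Rmult_le_reg_r with (1 := Pn).
      apply Rle_trans with (nu z * (2 ^ n * (1 - Cmod a ^ 2) ^ n)).
      - rewrite Rmult_assoc. apply Rmult_le_compat_l; lra.
      - apply Rle_trans with (2 ^ n * (nu z * (1 - Cmod a ^ 2) ^ n)); [lra|].
        replace (2 ^ n * K * nu a * (1 - Cmod z ^ 2) ^ n)
          with (2 ^ n * (K * nu a * (1 - Cmod z ^ 2) ^ n)) by ring.
        apply Rmult_le_compat_l; lra. }
    assert (B0 : 0 <= nu z * Cmod (peak a z) ^ n) by (apply Rmult_le_pos; [lra|apply pow_le; auto]).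
    simpl pow. apply Rle_trans with (2 * (2 ^ n * K * nu a)).
    + replace (nu z * (Cmod (peak a z) * Cmod (peak a z) ^ n))
        with (Cmod (peak a z) * (nu z * Cmod (peak a z) ^ n)) by ring.
      apply Rmult_le_compat; auto.
    + assert (0 < 2 ^ n * nu a) by (apply Rmult_lt_0_compat; auto). lra.
  - assert (B : nu z <= nu a) by (apply Hw; auto; lra).
    assert (D : Cmod (peak a z) ^ S n <= 2 ^ S n) by (apply pow_incr; auto).
    assert (T' : 0 < 2 ^ S n) by (apply pow_lt; lra).
    assert (D0 : 0 <= Cmod (peak a z) ^ S n) by (apply pow_le; auto).
    apply Rle_trans with (nu a * 2 ^ S n); [apply Rmult_le_compat; lra|].
    assert (0 < 2 ^ S n * nu a) by (apply Rmult_lt_0_compat; auto). nra.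
Qed.

Lemma test_function_norm a : inD a -> Hnorm_le nu (test_function nu n c a) 1.
Proof.
  intros Ha z Hz. rewrite Cmod_test_function by auto.
  assert (X := weighted_peak_bound a z Ha Hz).
  destruct Hnu as (_ & HK & Hpos & _). assert (Pa := Hpos a Ha).
  assert (T : 0 < 2 ^ S n * (K + 1)) by (apply Rmult_lt_0_compat; [apply pow_lt|]; lra).
  apply Rmult_le_compat_l with (r := c / nu a) in X; [|apply Rlt_le, test_scale_pos, Ha].
  replace (c / nu a * (2 ^ S n * (K + 1) * nu a)) with 1 in X.
  - lra.
  - unfold c. field. assert (0 < 2 ^ S n) by (apply pow_lt; lra). repeat split; try lra.
Qed.

Lemma holoD_test_function a : inD a -> holoD (test_function nu n c a).
Proof. intros Ha. eapply der_holoD. intros z Hz. apply der_test_function; auto. Qed.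

Lemma Cmod_dC_test_function a z : inD a -> inD z ->
  Cmod (dC (test_function nu n c a) z)
  = c / nu a * INR (S n) * Cmod (peak a z) ^ S n * (Cmod a * / Cmod (1 - Cconj a * z)).
Proof.
  intros Ha Hz. rewrite (dC_eq _ _ _ (der_test_function nu n c a z Ha Hz)). unfold test_derivative.
  assert (X := Cmod_peak_denom a z Ha Hz). assert (P := test_scale_pos a Ha).
  assert (Q := pos_INR (S n)).
  rewrite !Cmod_mult, Cmod_pow, Cmod_inv, Cmod_conj, !Cmod_R by (apply Cmod_neq0; lra).
  rewrite !Rabs_right by lra. rewrite <- tech_pow_Rmult. ring.
Qed.

(** At [z = a] the peak is 1 and its denominator is [1 - Cmod a ^ 2]. The factor [Cmod a] is
    harmless, since only points near the circle will be used. *)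
Lemma test_function_derivative_peak a : inD a ->
  c * Cmod a <= Cmod (dC (test_function nu n c a) a) * ((1 - Cmod a ^ 2) * nu a).
Proof.
  intros Ha. assert (P := one_minus_sqr_pos a Ha). assert (Pa : 0 < nu a) by (apply Hnu, Ha).
  assert (E : Cmod (1 - Cconj a * a) = 1 - Cmod a ^ 2).
  { rewrite (Cmult_comm (Cconj a)), <- Cmod2_conj, <- RtoC_minus, Cmod_R, Rabs_right; lra. }
  rewrite Cmod_dC_test_function, Cmod_peak, E by auto. rewrite Rinv_r, pow1 by lra.
  replace (c / nu a * INR (S n) * 1 * (Cmod a * / (1 - Cmod a ^ 2)) * ((1 - Cmod a ^ 2) * nu a))
    with (INR (S n) * (c * Cmod a)) by (field; lra).
  assert (Q : 0 <= c * Cmod a) by (apply Rmult_le_pos; [apply Rlt_le, test_const_pos|apply Cmod_ge_0]).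
  rewrite S_INR. assert (R := pos_INR n). nra.
Qed.

(** Stands in for weak convergence to 0: [B] may depend on [z] but not on [a]. Property (U) between
    0 and [a] gives [(1 - Cmod a ^ 2) ^ n <= K * nu a / nu 0], which cancels the division by
    [nu a]. *)
Lemma test_function_derivative_decay z : inD z -> exists B, 0 <= B /\ forall a, inD a ->
  Cmod (dC (test_function nu n c a) z) <= B * (1 - Cmod a ^ 2).
Proof.
  intros Hz. assert (Hz' := Hz). unfold inD in Hz'.
  destruct Hnu as (_ & HK & Hpos & Hreg). assert (P0 := Hpos 0%C inD_0).
  assert (Pc := test_const_pos). set (y := / (1 - Cmod z)).
  assert (Hy : 0 < y) by (apply Rinv_0_lt_compat; lra).
  assert (Pn := pos_INR (S n)).
  set (B := K * c / nu 0 * INR (S n) * y ^ S n * y). exists B.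
  assert (HB : 0 <= B).
  { unfold B. assert (0 < y ^ S n) by (apply pow_lt; auto).
    assert (0 < K * c / nu 0) by (apply Rdiv_lt_0_compat; auto; apply Rmult_lt_0_compat; auto).
    apply Rmult_le_pos; [|lra]. apply Rmult_le_pos; [|lra]. apply Rmult_le_pos; lra. }
  split; [exact HB|]. intros a Ha.
  assert (Pa := Hpos a Ha). assert (X := Cmod_peak_denom a z Ha Hz).
  assert (Q := one_minus_sqr_pos a Ha). set (x := 1 - Cmod a ^ 2) in *.
  rewrite Cmod_dC_test_function by auto.
  assert (R1 : x ^ n <= K * nu a / nu 0).
  { specialize (Hreg 0%C a inD_0 Ha). rewrite Cmod_0 in Hreg. specialize (Hreg (Cmod_ge_0 a)). fold x in Hreg.
    replace ((1 - 0 ^ 2) ^ n) with 1 in Hreg by (rewrite <- (pow1 n) at 1; f_equal; ring).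
    apply Rmult_le_reg_r with (1 := P0). replace (K * nu a / nu 0 * nu 0) with (K * nu a) by (field; lra).
    lra. }
  assert (R2 : Cmod (peak a z) ^ S n <= (x * y) ^ S n).
  { apply pow_incr. split; [apply Cmod_ge_0|apply Cmod_peak_le_quot; auto]. }
  assert (R3 : Cmod a * / Cmod (1 - Cconj a * z) <= 1 * y).
  { apply Rmult_le_compat; [apply Cmod_ge_0| |unfold inD in Ha; lra|].
    - apply Rlt_le, Rinv_0_lt_compat. lra.
    - apply Rinv_le_contravar; lra. }
  assert (S1 := test_scale_pos a Ha).
  assert (S2 : 0 <= Cmod a * / Cmod (1 - Cconj a * z)).
  { apply Rmult_le_pos; [apply Cmod_ge_0|]. apply Rlt_le, Rinv_0_lt_compat. lra. }
  assert (S3 : 0 <= c / nu a * INR (S n)) by (apply Rmult_le_pos; lra).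
  apply Rle_trans with (c / nu a * INR (S n) * (x * y) ^ S n * (1 * y)).
  - apply Rmult_le_compat; auto.
    + apply Rmult_le_pos; auto. apply pow_le, Cmod_ge_0.
    + apply Rmult_le_compat_l; auto.
  - rewrite Rpow_mult_distr, <- (tech_pow_Rmult x).
    replace (c / nu a * INR (S n) * (x * x ^ n * y ^ S n) * (1 * y))
      with (c / nu a * INR (S n) * x * y ^ S n * y * x ^ n) by ring.
    apply Rle_trans with (c / nu a * INR (S n) * x * y ^ S n * y * (K * nu a / nu 0)).
    + apply Rmult_le_compat_l; auto. assert (0 < y ^ S n) by (apply pow_lt; auto).
      apply Rmult_le_pos; [|lra]. apply Rmult_le_pos; [|lra]. apply Rmult_le_pos; lra.
    + right. unfold B. field. lra.
Qed.

End TestFunctions.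

Lemma Rle_0_of_small x : (forall eps, 0 < eps -> x <= eps) -> x <= 0.
Proof. intros H. apply Rnot_lt_le. intros L. specialize (H (x / 2)). lra. Qed.

Lemma symbol_of_compact g nu mu n K (X Y : (C -> C) -> Prop) :
  holoD g -> regular_weight nu n K -> weight mu ->
  (forall f B, holoD f -> (forall z, inD z -> Cmod (f z) <= B) -> X f) ->
  (forall h, Y h -> holoD h) ->
  compact_op X nu Y mu (Sg g) -> lim_bdry0 (symbol g nu mu).
Proof.
  intros Hg Hnu Hmu HX HY [_ Hcomp] eps He. apply NNPP. intros Nlim.
  (* Starting the denominators at 2 makes every chosen point satisfy [1 / 2 < Cmod a], which bounds
     the factor [Cmod a] of the peak derivative from below. *)
  assert (Hbad : forall k : nat, exists a, inD a /\ 1 - / INR (S (S k)) < Cmod a /\ eps <= symbol g nu mu a).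
  { intros k. apply NNPP. intros N. apply Nlim. exists (1 - / INR (S (S k))). split.
    - assert (0 < / INR (S (S k))) by (apply Rinv_0_lt_compat, lt_0_INR; lia). lra.
    - intros z Hz Hzr. assert (P := symbol_nonneg g nu mu n K z Hnu Hmu Hz).
      rewrite Rabs_right by lra. apply Rnot_le_lt. intros L. apply N. exists z. auto. }
  apply functional_choice in Hbad. destruct Hbad as [a Ha].
  set (c := / (2 ^ S n * (K + 1))). assert (Hc : 0 < c) by (apply (test_const_pos nu n K Hnu)).
  set (T := fun b => test_function nu n c b).
  assert (HT : forall b, inD b -> holoD (T b)) by (intros b Hb; apply (holoD_test_function nu n K b Hb)).
  destruct (Hcomp (fun k => T (a k))) as (phi & h & Hphi & Yh & Hcv).
  { intros k. assert (Dk := proj1 (Ha k)). split.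
    - apply HX with (c / nu (a k) * 2 ^ S n); auto.
      intros z Hz. apply (test_function_bounded nu n K Hnu); auto.
    - apply (test_function_norm nu n K Hnu); auto. }
  assert (Hh := HY h Yh).
  assert (Hcv' : forall eta, 0 < eta -> exists N, forall k, (N <= k)%nat -> forall z, inD z ->
    mu z * Cmod (dC (T (a (phi k))) z * g z - dC h z) <= eta).
  { intros eta Heta. destruct (Hcv eta Heta) as [N HN]. exists N. intros k Hk z Hz.
    assert (Dk := proj1 (Ha (phi k))). specialize (HN k Hk z Hz).
    rewrite dC_minus, dC_Sg in HN by (auto using holoD_Sg).
    (* The value at 0 is dropped from the norm: the rest of the argument concerns derivatives
       only. *)
    assert (P := Cmod_ge_0 (Sg g (T (a (phi k))) 0 - h 0)). lra. }
  assert (Hak : forall k, 1 - Cmod (a (phi k)) ^ 2 <= 2 * / INR (S (S k))).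
  { intros k. destruct (Ha (phi k)) as (D1 & D2 & _). unfold inD in D1. assert (P := Cmod_ge_0 (a (phi k))).
    assert (L : / INR (S (S (phi k))) <= / INR (S (S k))).
    { apply Rinv_le_contravar; [apply lt_0_INR; lia|]. apply le_INR.
      assert (X1 := extraction_ge phi k Hphi). lia. }
    nra. }
  (* Norm convergence controls [dC h z] only through the weight, and [mu] may vanish, so it is the
     weighted derivative that is shown to be zero. *)
  assert (Hzero : forall z, inD z -> mu z * Cmod (dC h z) <= 0).
  { intros z Hz. apply Rle_0_of_small. intros eta Heta.
    destruct (test_function_derivative_decay nu n K Hnu z Hz) as (B & HB & HBa). fold c in HBa.
    assert (Q := weight_le_0 mu z Hmu Hz). assert (Pg := Cmod_ge_0 (g z)).
    set (A := mu z * (2 * B * Cmod (g z))).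
    assert (HA : 0 <= A) by (unfold A; apply Rmult_le_pos; [lra|]; apply Rmult_le_pos; lra).
    destruct (Hcv' (eta / 2)) as [N1 HN1]; [lra|].
    destruct (archimed_cor1 (eta / (2 * (A + 1)))) as (N2 & HN2 & HN20); [apply Rdiv_lt_0_compat; lra|].
    set (k := max N1 N2). specialize (HN1 k ltac:(unfold k; lia) z Hz).
    assert (L : / INR (S (S k)) <= / INR N2).
    { apply Rinv_le_contravar; [apply lt_0_INR; auto|apply le_INR; unfold k; lia]. }
    specialize (HBa (a (phi k)) (proj1 (Ha (phi k)))). specialize (Hak k).
    change (test_function nu n c (a (phi k))) with (T (a (phi k))) in HBa.
    set (d := dC (T (a (phi k))) z) in *. set (e := / INR (S (S k))) in *.
    assert (D1 : Cmod d <= B * (2 * e)).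
    { apply Rle_trans with (1 := HBa). apply Rmult_le_compat_l; auto. }
    assert (D2 : Cmod (dC h z) <= Cmod (d * g z) + Cmod (d * g z - dC h z)).
    { assert (Y1 := Cmod_sub_le (d * g z) (d * g z - dC h z)).
      replace (d * g z - (d * g z - dC h z))%C with (dC h z) in Y1 by ring. auto. }
    rewrite (Cmod_mult d) in D2.
    assert (D3 : mu z * (Cmod d * Cmod (g z)) <= A * e).
    { unfold A. replace (mu z * (2 * B * Cmod (g z)) * e) with (mu z * (B * (2 * e) * Cmod (g z))) by ring.
      apply Rmult_le_compat_l; [lra|]. apply Rmult_le_compat_r; auto. }
    assert (D4 : A * e <= eta / 2).
    { apply Rle_trans with ((A + 1) * (eta / (2 * (A + 1)))).
      - apply Rmult_le_compat; try lra. unfold e. apply Rlt_le, Rinv_0_lt_compat, lt_0_INR. lia.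
      - right. field. lra. }
    assert (D5 : mu z * Cmod (dC h z) <= mu z * (Cmod d * Cmod (g z) + Cmod (d * g z - dC h z)))
      by (apply Rmult_le_compat_l; lra).
    lra. }
  (* At the peak point [b], with [1 / 2 <= Cmod b], the weighted derivative of the image is at least
     [c * eps / 2], while that of [h] is zero; any tolerance below [c * eps / 2] gives the
     contradiction. *)
  destruct (Hcv' (c * eps / 4)) as [N HN].
  { assert (0 < c * eps) by (apply Rmult_lt_0_compat; auto). lra. }
  specialize (HN N (le_n N)). destruct (Ha (phi N)) as (D1 & D2 & D3).
  set (b := a (phi N)) in *. specialize (HN b D1). specialize (Hzero b D1).
  assert (Hb : 1 / 2 <= Cmod b).
  { assert (L : / INR (S (S (phi N))) <= / 2).
    { apply Rinv_le_contravar; [lra|]. apply (le_INR 2). lia. } lra. }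
  assert (E := test_function_derivative_peak nu n K Hnu b D1). fold c in E. fold (T b) in E.
  assert (Q := weight_le_0 mu b Hmu D1).
  assert (F1 : symbol g nu mu b * (c * Cmod b) <= mu b * Cmod (dC (T b) b * g b)).
  { rewrite Cmod_mult.
    replace (mu b * (Cmod (dC (T b) b) * Cmod (g b))) with (Cmod (dC (T b) b) * (mu b * Cmod (g b))) by ring.
    rewrite (symbol_mult g nu mu n K b Hnu D1).
    apply Rmult_le_compat_l with (r := symbol g nu mu b) in E; [|lra]. lra. }
  assert (F2 : Cmod (dC (T b) b * g b) <= Cmod (dC (T b) b * g b - dC h b) + Cmod (dC h b)).
  { assert (Y1 := Cmod_triangle (dC (T b) b * g b - dC h b) (dC h b)).
    replace (dC (T b) b * g b - dC h b + dC h b)%C with (dC (T b) b * g b)%C in Y1 by ring. auto. }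
  assert (F3 : mu b * Cmod (dC (T b) b * g b)
      <= mu b * (Cmod (dC (T b) b * g b - dC h b) + Cmod (dC h b))) by (apply Rmult_le_compat_l; lra).
  assert (F4 : eps * (c * (1 / 2)) <= symbol g nu mu b * (c * Cmod b)).
  { apply Rmult_le_compat; try lra. apply Rmult_le_compat_l; lra. }
  assert (0 < c * eps) by (apply Rmult_lt_0_compat; auto). lra.
Qed.

Lemma Hinf_of_bounded nu f B : weight nu -> holoD f -> (forall z, inD z -> Cmod (f z) <= B) -> Hinf nu f.
Proof.
  intros Hw Hf HB. split; auto. exists (nu 0 * B). intros z Hz. assert (P := weight_le_0 nu z Hw Hz).
  apply Rmult_le_compat; try lra; auto using Cmod_ge_0.
Qed.

Lemma H0_of_bounded nu f B : weight nu -> typical nu -> holoD f ->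
  (forall z, inD z -> Cmod (f z) <= B) -> H0 nu f.
Proof.
  intros Hw Ht Hf HB. split; auto. intros eps He.
  assert (B0 : 0 <= B) by (eapply Rle_trans; [apply Cmod_ge_0|apply (HB 0%C inD_0)]).
  destruct (Ht (eps / (B + 1))) as (r & Hr & H); [apply Rdiv_lt_0_compat; lra|].
  exists r. split; auto. intros z Hz Hzr. specialize (H z Hz Hzr). specialize (HB z Hz).
  assert (P := weight_le_0 nu z Hw Hz). assert (Pf := Cmod_ge_0 (f z)).
  rewrite Rabs_right in H by lra. rewrite Rabs_right by (apply Rle_ge, Rmult_le_pos; lra).
  apply Rmult_lt_compat_r with (r := B + 1) in H; [|lra].
  replace (eps / (B + 1) * (B + 1)) with eps in H by (field; lra).
  apply Rle_lt_trans with (2 := H). apply Rmult_le_compat; lra.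
Qed.

Lemma H0_Hnorm nu f : weight nu -> H0 nu f -> holoD f /\ exists M, Hnorm_le nu f M.
Proof. intros Hw [Hf Hlim]. split; auto. apply weighted_bound_of_lim_bdry0; auto. Qed.

Theorem theorem11 (g : C -> C) (nu mu : C -> R) :
  holoD g -> weight nu -> propU nu -> weight mu -> 0 < nu 0 ->
  (compact_op (Hinf nu) nu (Binf mu) mu (Sg g) <->
     lim_bdry0 (fun z => mu z / ((1 - Cmod z ^ 2) * nu z) * Cmod (g z)))
  /\
  (typical nu -> typical mu ->
     (compact_op (Hinf nu) nu (Binf mu) mu (Sg g) <->
        compact_op (H0 nu) nu (B0 mu) mu (Sg g))).
Proof.
  intros Hg Hnu HU Hmu Hnu0.
  destruct (propU_regular nu Hnu HU Hnu0) as (n & K & Hreg).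
  assert (E : compact_op (Hinf nu) nu (Binf mu) mu (Sg g) <-> lim_bdry0 (symbol g nu mu)).
  { split.
    - apply (symbol_of_compact g nu mu n K); auto.
      + intros f B. apply Hinf_of_bounded, Hnu.
      + intros h Hh. apply Hh.
    - apply (compact_of_symbol g nu mu n K); auto.
      (* Even here the images have vanishing weighted derivative, which is stronger than the bound
         in [Binf]. *)
      intros h Hh Hlim. split; auto. apply weighted_bound_of_lim_bdry0; auto using holoD_dC. }
  split; [exact E|]. intros Htn Htm. rewrite E. split.
  - apply (compact_of_symbol g nu mu n K); auto.
    + intros f. apply H0_Hnorm, Hnu.
    + intros h Hh Hlim. split; auto.
  - apply (symbol_of_compact g nu mu n K); auto.
    + intros f B. apply H0_of_bounded; auto.
    + intros h Hh. apply Hh.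
Qed.
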